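(* If $M$ is a separable $\mathrm{II}_1$ factor and $t>0$, then $$\mathcal G_{\mathrm{sa}}(M_t)=t^{-2}\,\mathcal G_{\mathrm{sa}}(M).$$
   Context: For a $\mathrm{II}_1$ factor $M$ with its faithful normal trace $\tau$, $\tau(1)=1$, let $\mathcal P(M)$ be the collection of all finite sets of mutually orthogonal projections in $M$ which sum to $1$. For $x\in M$ and $P\in\mathcal P(M)$ put $\mathcal I(x;P)=\sum_{p,q\in P,\ pxq\neq 0}\tau(p)\tau(q)$. For a finite subset $X\subset M$ put $\mathcal I(X;P)=\sum_{x\in X}\mathcal I(x;P)$ and $\mathcal I(X)=\inf_{P\in\mathcal P(M)}\mathcal I(X;P)$. $W^*(X)$ denotes the von Neumann algebra generated by $X$ (not automatically assumed to contain the identity of $M$). The hermitian generator invariant is $\mathcal G_{\mathrm{sa}}(M)=\inf\{\mathcal I(X): X\subset M_{\mathrm{sa}}\text{ finite},\ W^*(X)=M\}$, where $M_{\mathrm{sa}}$ is the set of self-adjoint elements of $M$, with $\mathcal G_{\mathrm{sa}}(M)=\infty$ if $M$ is not finitely generated. For $t>0$, the amplification $M_t$ is the $\mathrm{II}_1$ factor $p(\mathbb M_n(\mathbb C)\otimes M)p$, where $n$ is any integer greater than $t$ and $p\in\mathbb M_n(\mathbb C)\otimes M$ is a projection of normalised trace $t/n$; up to isomorphism it depends only on $M$ and $t$. The invariant of $M_t$ is computed with the normalised trace of $M_t$. *)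

(* Defs.v *)
From HB Require Import structures.
From mathcomp Require Import all_boot all_order all_algebra finmap.
From mathcomp Require Import sesquilinear complex.
From mathcomp Require Import all_classical all_reals all_analysis.

Set Implicit Arguments.
Unset Strict Implicit.
Unset Printing Implicit Defensive.

Import Order.TTheory GRing.Theory Num.Theory.
Import numFieldNormedType.Exports.

Local Open Scope classical_set_scope.
Local Open Scope complex_scope.
Local Open Scope ring_scope.

(* Inner products are linear in the first variable. *)
HB.mixin Record isHilbert (R : realType) H of CompleteNormedModule R[i] H := {
  hdot : {dot H for @Num.conj R[i]} ;
  hdotxx : forall x : H, hdot x x = `|x| ^+ 2
}.

#[short(type="hilbertType")]
HB.structure Definition Hilbert (R : realType) :=
  {H of CompleteNormedModule R[i] H & isHilbert R H}.

Section DotNorm.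
Variables (C : numClosedFieldType) (U : lmodType C).
Variable form : {dot U for @Num.conj C}.

Lemma dot_ge0 x : 0 <= form x x.
Proof.
by have [->|x0] := eqVneq x 0; rewrite ?linear0 // ltW // neq0_dnorm_gt0.
Qed.

Lemma dot_conj x y : form x y = Num.conj (form y x).
Proof. by rewrite hermitian_subproof expr0 mul1r. Qed.

Lemma dot_pythagoras x y : form x y = 0 ->
  form (x + y) (x + y) = form x x + form y y.
Proof.
move=> xy; have yx : form y x = 0 by rewrite dot_conj xy rmorph0.
by rewrite linearDl /= !linearD /= xy yx addr0 add0r.
Qed.

Lemma dot_CauchySchwarz x y :
  `|form x y| <= sqrtC (form x x) * sqrtC (form y y).
Proof.
rewrite -(sqrCK (normr_ge0 _)) -sqrtCM ?nnegrE ?dot_ge0 //.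
rewrite ler_sqrtC ?nnegrE ?exprn_ge0 ?mulr_ge0 ?dot_ge0 //.
have [->|y0] := eqVneq y 0; first by rewrite !linear0 normr0 expr0n mulr0.
have yy : 0 < form y y by exact: neq0_dnorm_gt0.
pose a := form x y / form y y; pose z := x - a *: y.
have zy : form z y = 0.
  by rewrite linearBl /= linearZl_LR /= divfK ?gt_eqF // subrr.
have -> : form x x = form z z + a * Num.conj a * form y y.
  rewrite -{1 2}(subrK (a *: y) x) -/z dot_pythagoras.
    by rewrite linearZl_LR linearZr_LR /= mulrA.
  by rewrite linearZr_LR /= zy mulr0.
rewrite mulrDl -normCK.
suff -> : `|a| ^+ 2 * form y y * form y y = `|form x y| ^+ 2.
  by rewrite lerDr mulr_ge0 ?dot_ge0.
rewrite -mulrA -expr2 -[X in _ * X ^+ 2](gtr0_norm yy) -exprMn -normrM.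
by rewrite divfK // gt_eqF.
Qed.

Lemma dot_triangle x y :
  sqrtC (form (x + y) (x + y)) <= sqrtC (form x x) + sqrtC (form y y).
Proof.
rewrite -ler_sqr ?nnegrE ?addr_ge0 ?sqrtC_ge0 ?dot_ge0 //.
rewrite sqrrD !sqrtCK linearDl /= !linearD /= (dot_conj y x).
rewrite addrA lerD2r -addrA lerD2l.
apply: (@le_trans _ _ `|form x y + Num.conj (form x y)|).
  by rewrite real_ler_norm // CrealE rmorphD /= conjCK addrC.
apply: le_trans (ler_normD _ _) _.
by rewrite norm_conjC -mulr2n lerMn2r dot_CauchySchwarz orbT.
Qed.

End DotNorm.

(* The Hilbert direct sum of n copies of H, that is, C^n (x) H. *)
Definition hsum (R : realType) (H : hilbertType R) (n : nat) : Type :=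
  {ffun 'I_n -> H}.

Section HilbertSum.
Variables (R : realType) (H : hilbertType R) (n : nat).
Local Notation C := R[i].
Local Notation K := (hsum H n).

HB.instance Definition _ := GRing.Lmodule.copy K {ffun 'I_n -> H}.
HB.instance Definition _ := Choice.copy K {ffun 'I_n -> H}.

Definition hsum_dot (x y : K) : C :=
  \sum_(i < n) hdot (x i : H) (y i : H).

Lemma hsum_dot_bilinear : bilinear_for
  (GRing.mul : GRing.Scale.law C C)
  (@Num.conj C \; *%R : GRing.Scale.law C C) hsum_dot.
Proof.
split=> [z a x y | z a x y]; rewrite /hsum_dot /= mulr_sumr -big_split /=;
  apply: eq_bigr => i _; rewrite !ffunE.
  by rewrite linearDl /= linearZl_LR.
by rewrite linearD /= linearZr_LR.
Qed.

HB.instance Definition _ := bilinear_isBilinear.Build C K K C _ _ hsum_dot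
  hsum_dot_bilinear.

Lemma hsum_dot_herm (x y : K) :
  hsum_dot x y = (-1) ^+ false * Num.conj (hsum_dot y x).
Proof.
rewrite expr0 mul1r /hsum_dot rmorph_sum; apply: eq_bigr => i _ /=.
by rewrite (@hermitian_subproof _ _ _ _ hdot) expr0 mul1r.
Qed.

HB.instance Definition _ := isHermitianSesquilinear.Build C K false
  (@Num.conj C) hsum_dot hsum_dot_herm.

Lemma hsum_dotxx (x : K) : hsum_dot x x = \sum_(i < n) `|x i| ^+ 2.
Proof. by apply: eq_bigr => i _; rewrite hdotxx. Qed.

Lemma hsum_dot_gt0 (x : K) : x != 0 -> 0 < hsum_dot x x.
Proof.
move=> x0; have [i xi0] : exists i, x i != 0.
  apply/existsP; apply: contraNT x0 => /existsPn x0.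
  by apply/eqP/ffunP => i; rewrite ffunE; apply/eqP; move: (x0 i); rewrite negbK.
rewrite hsum_dotxx (bigD1 i) //= ltr_pwDl //.
  by rewrite exprn_gt0 // normr_gt0.
by apply: sumr_ge0 => j _; rewrite exprn_ge0.
Qed.

HB.instance Definition _ := isDotProduct.Build C K hsum_dot hsum_dot_gt0.

Definition hsum_norm (x : K) : C := sqrtC (hsum_dot x x).

Lemma hsum_norm_ge0 (x : K) : 0 <= hsum_norm x.
Proof. by rewrite sqrtC_ge0 hsum_dotxx sumr_ge0 // => i _; rewrite exprn_ge0. Qed.

Lemma hsum_normZ (a : C) (x : K) : hsum_norm (a *: x) = `|a| * hsum_norm x.
Proof.
rewrite /hsum_norm !hsum_dotxx -[X in X * _](sqrCK (normr_ge0 a)).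
rewrite -sqrtCM ?nnegrE ?exprn_ge0 //; last first.
  by apply: sumr_ge0 => i _; rewrite exprn_ge0.
congr sqrtC; rewrite mulr_sumr; apply: eq_bigr => i _.
by rewrite ffunE normrZ exprMn.
Qed.

Lemma hsum_norm_eq0 (x : K) : hsum_norm x = 0 -> x = 0.
Proof.
move=> /eqP; rewrite sqrtC_eq0 => /eqP x0; apply/eqP; apply: contraPT x0.
by move=> /hsum_dot_gt0 x0; apply/eqP; rewrite gt_eqF.
Qed.

Lemma le_hsum_norm (x : K) i : `|x i| <= hsum_norm x.
Proof.
rewrite -(sqrCK (normr_ge0 (x i))) ler_sqrtC ?nnegrE ?exprn_ge0 //; last first.
  by rewrite hsum_dotxx sumr_ge0 // => j _; rewrite exprn_ge0.
by rewrite hsum_dotxx (bigD1 i) //= lerDl sumr_ge0 // => j _; rewrite exprn_ge0.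
Qed.

Lemma hsum_norm_le (x : K) : hsum_norm x <= \sum_i `|x i|.
Proof.
have S0 : 0 <= \sum_i `|x i| by exact: sumr_ge0.
rewrite -[leRHS](sqrCK S0) ler_sqrtC ?nnegrE ?exprn_ge0 //; last first.
  by rewrite hsum_dotxx sumr_ge0 // => j _; rewrite exprn_ge0.
rewrite hsum_dotxx expr2 mulr_suml; apply: ler_sum => i _.
by rewrite expr2 ler_wpM2l // (bigD1 i) //= lerDl sumr_ge0.
Qed.

Lemma hsum_normD (x y : K) : hsum_norm (x + y) <= hsum_norm x + hsum_norm y.
Proof. exact: (dot_triangle (hsum_dot : {dot K for @Num.conj C})). Qed.

HB.instance Definition _ := Lmodule_isNormed.Build C K hsum_normD hsum_normZ
  hsum_norm_eq0.

Lemma hsum_complete (F : set_system K) : ProperFilter F -> cauchy F -> cvg F.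
Proof.
move=> FF /cauchy_ballP Fc.
have cvgi i : cvg ((fun x : K => x i : H) @ F).
  apply: cauchy_cvg; apply/cauchy_ballP => e e0.
  rewrite !near_simpl; apply: filterS (Fc _ e0) => -[x y] /=.
  rewrite -!ball_normE /=; apply: le_lt_trans.
  by have := le_hsum_norm (x - y) i; rewrite !ffunE.
apply/cvg_ex; exists ([ffun i => lim ((fun x : K => x i : H) @ F)] : K).
apply/cvgrPdist_le => e e0.
have en0 : 0 < e / n.+1%:R :> C by rewrite divr_gt0.
have : F [set x : K | forall i : 'I_n,
    `|lim ((fun x : K => x i : H) @ F) - x i| <= e / n.+1%:R].
  apply: filter_forall => i.
  by have /cvgrPdist_le/(_ _ en0) := cvgi i.
apply: filterS => x xe; apply: le_trans (hsum_norm_le _) _.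
apply: (@le_trans _ _ (\sum_(i < n) e / n.+1%:R)).
  by apply: ler_sum => i _; rewrite !ffunE.
rewrite sumr_const card_ord -[leLHS]mulr_natr mulrAC ler_pdivrMr ?ltr0n // ler_wpM2l ?ltW //.
by rewrite ltr_nat.
Qed.

HB.instance Definition _ := Uniform_isComplete.Build K hsum_complete.

Lemma hsum_dotxx_norm (x : K) : hsum_dot x x = `|x| ^+ 2.
Proof. by rewrite sqrtCK. Qed.

HB.instance Definition _ := isHilbert.Build R K hsum_dotxx_norm.

End HilbertSum.
Section Operators.
Variables (R : realType) (H : hilbertType R).
Local Notation C := R[i].
Implicit Types (x y p q e T S : H -> H) (M N : set (H -> H)).

Definition bounded_operators : set (H -> H) :=
  [set T | linear T /\ continuous T].

Definition adjoint T S := forall u v : H, hdot (T u) v = hdot u (S v).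

Definition self_adjoint T := adjoint T T.

Definition is_projection p := p \o p = p /\ self_adjoint p.

Definition is_unit M e := M e /\ forall x, M x -> e \o x = x /\ x \o e = x.

(* A *-subalgebra of B(H) closed in B(H) for the strong operator topology,
   the topology of pointwise norm convergence on H. Its unit is a projection
   which need not be the identity of H, so that corners p N p are von Neumann
   algebras in this sense. *)
Record von_neumann_algebra M : Prop := VonNeumannAlgebra {
  vna_bounded : M `<=` bounded_operators ;
  vna0 : M 0 ;
  vna_linear : forall (a : C) x y, M x -> M y -> M (a *: x + y) ;
  vna_comp : forall x y, M x -> M y -> M (x \o y) ;
  vna_adjoint : forall x, M x -> exists2 y, M y & adjoint x y ;
  vna_closed :
    bounded_operators `&` closure (M : set {ptws H -> H}) `<=` M
}.

Definition generated_vna (X : set (H -> H)) : set (H -> H) :=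
  smallest von_neumann_algebra X.

(* The elements of the predual of M: the ultraweakly continuous functionals,
   i.e. x |-> \sum_k <x xi_k, eta_k> with square summable xi and eta. Values
   outside M are irrelevant. *)
Definition normal_functional M (phi : (H -> H) -> C) :=
  exists xi eta : nat -> H,
    [/\ cvg (series (fun k => `|xi k| ^+ 2 : C^o) @ \oo),
        cvg (series (fun k => `|eta k| ^+ 2 : C^o) @ \oo) &
        forall x, M x ->
          series (fun k => hdot (x (xi k)) (eta k) : C^o) @ \oo -->
            (phi x : C^o)].

(* Separability of the predual for the norm sup {|phi x| : x in the unit ball
   of M}. *)
Definition separable_vna M :=
  exists phi : nat -> (H -> H) -> C,
    (forall k, normal_functional M (phi k)) /\
    forall psi, normal_functional M psi -> forall eps : C, 0 < eps ->
      exists k, forall x, M x -> (forall u, `|x u| <= `|u|) ->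
        `|psi x - phi k x| <= eps.

Record faithful_normal_trace M (tau : (H -> H) -> C) : Prop :=
  FaithfulNormalTrace {
  tau_linear : forall (a : C) x y, M x -> M y ->
    tau (a *: x + y) = a * tau x + tau y ;
  tau_ge0 : forall x y, M x -> M y -> adjoint x y -> 0 <= tau (y \o x) ;
  tau_faithful : forall x y, M x -> M y -> adjoint x y ->
    tau (y \o x) = 0 -> x = 0 ;
  tau_trace : forall x y, M x -> M y -> tau (x \o y) = tau (y \o x) ;
  tau1 : forall e, is_unit M e -> tau e = 1 ;
  tau_normal : normal_functional M tau
}.

Record factor M : Prop := Factor {
  factor_vna : von_neumann_algebra M ;
  factor_unit : exists e, is_unit M e /\
    forall z, M z -> (forall x, M x -> z \o x = x \o z) ->
      exists a : C, z = a *: e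
}.

Definition infinite_dimensional M :=
  ~ exists s : seq (H -> H), forall x, M x ->
      exists c : nat -> C, x = \sum_(i < size s) c i *: s`_i.

(* A factor with a faithful normal trace is finite, hence of type I_n or II_1;
   infinite dimension excludes the former. *)
Definition II1_factor M (tau : (H -> H) -> C) :=
  [/\ factor M, infinite_dimensional M & faithful_normal_trace M tau].

Section Invariant.
Variables (M : set (H -> H)) (tau : (H -> H) -> C).

Definition partition_of_unity : set {fset H -> H} :=
  [set P : {fset H -> H} |
            [/\ forall p, p \in P -> M p /\ is_projection p,
               forall p q, p \in P -> q \in P -> p != q -> p \o q = 0 &
               is_unit M (\sum_(p <- P) p)]].

(* Traces of projections are real, so taking real parts loses nothing. *)
Definition support_size (x : H -> H) (P : {fset H -> H}) : R :=
  \sum_(p <- P) \sum_(q <- P | p \o x \o q != 0)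
    complex.Re (tau p) * complex.Re (tau q).

Definition finset_invariant (X : {fset H -> H}) : \bar R :=
  ereal_inf [set (\sum_(x <- X) support_size x P)%:E | P in partition_of_unity].

(* ereal_inf set0 = +oo is the value for M not finitely generated. *)
Definition G_sa : \bar R :=
  ereal_inf [set finset_invariant X | X in
    [set X : {fset H -> H} | (forall x, x \in X -> M x /\ self_adjoint x) /\
                             generated_vna [set` X] = M]].

End Invariant.

Definition corner N p : set (H -> H) := [set p \o x \o p | x in N].

Definition corner_trace (phi : (H -> H) -> C) p : (H -> H) -> C :=
  fun x => phi x / phi p.

End Operators.

Section Amplification.
Variables (R : realType) (H : hilbertType R) (n : nat).
Local Notation C := R[i].

Definition hsum_inj (i : 'I_n) (v : H) : hsum H n :=
  [ffun j => if j == i then v else 0].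

Definition entry (T : hsum H n -> hsum H n) (i j : 'I_n) : H -> H :=
  fun v => T (hsum_inj j v) i.

(* M_n(C) (x) M is the algebra of operators on C^n (x) H with matrix entries
   in M; its normalised trace is tr_n (x) tau. *)
Definition matrix_vna (M : set (H -> H)) : set (hsum H n -> hsum H n) :=
  [set T | bounded_operators T /\ forall i j, M (entry T i j)].

Definition matrix_trace (tau : (H -> H) -> C)
    (T : hsum H n -> hsum H n) : C :=
  n%:R^-1 * \sum_(i < n) tau (entry T i i).

End Amplification.

(* Main.v *)
(* Let [M] and [N] be finite factors with isomorphic corners on which the traces
   are proportional with ratio [c]; for the amplification, [c = 1/t]. Given
   generators [X] of [M] and a partition [P] of its unit, choose a projection
   [e] of very small trace in the corner of [M], with image [f] in [N], and cut
   every [p] in [P] into projections [v v^*] with [v^* v = e], plus one remainder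
   with [v^* v <= e]. The entries [v^* x v'] lie in [e M e]; transported to
   [f N f], each of them costs at most the square of the trace of [f] with
   respect to a partition of the unit of [N] containing [f], and they generate
   [f N f]. Together with partial
   isometries from [f] to the pieces of a decomposition of [1 - f], whose cost
   tends to 0 with the trace of [e], they generate [N], at total cost close to
   [c^2 I(X; P)]. Exchanging [M] and [N] gives equality.

   Cutting projections requires comparison, hence partial isometries in [M]. They
   come from Newton's iteration [x (3 - x^* x) / 2], which only involves
   polynomials and converges strongly to the partial isometry of the polar
   decomposition. *)
Require Import Defs.
From HB Require Import structures.
From mathcomp Require Import all_boot all_order all_algebra finmap.
From mathcomp Require Import sesquilinear complex.
From mathcomp Require Import all_classical all_reals all_analysis.
From mathcomp Require Import ring lra.
Import Order.TTheory GRing.Theory Num.Theory.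
Import numFieldNormedType.Exports.
Local Open Scope classical_set_scope.
Local Open Scope complex_scope.
Local Open Scope ring_scope.

Set Implicit Arguments.
Unset Strict Implicit.
Unset Printing Implicit Defensive.

(** * Bounded operators as a *-algebra *)

(** The exponent 2 comes from a count: [p] gives about [tr p / tr e] pieces, so the pair [p], [q]
    gives about [tr p * tr q / tr e ^ 2] entries, each of cost at most [(c * tr e) ^ 2]. A remainder
    only replaces [tr p] by [tr p + tr e], so for fixed [X] and [P] the error vanishes with [tr e].
    Two constraints shape the rest. Generators must be self-adjoint and entries are not; each pair
    of mutually adjoint entries is therefore replaced by two self-adjoint combinations, which keeps
    the number of generators. And no spectral theorem is used, only polynomials and strong limits of
    sequences. Maximal partial isometries exist because the trace is bounded and increasing on them;
    being a factor is used only in the form that [x M y] is nonzero for nonzero [x] and [y]; small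
    projections exist because the sign of a self-adjoint element shows that a minimal projection
    would make the algebra finite-dimensional. *)

Section InnerProduct.
Variables (R : realType) (H : hilbertType R).
Implicit Types (u v w : H) (c : R[i]).

Lemma hdotDl u v w : hdot (u + v) w = hdot u w + hdot v w.
Proof. exact: linearDl. Qed.

Lemma hdotDr u v w : hdot w (u + v) = hdot w u + hdot w v.
Proof. exact: linearD. Qed.

Lemma hdotZl c u v : hdot (c *: u) v = c * hdot u v.
Proof. exact: linearZl_LR. Qed.

Lemma hdotZr c u v : hdot u (c *: v) = Num.conj c * hdot u v.
Proof. exact: linearZr_LR. Qed.

Lemma hdotNl u v : hdot (- u) v = - hdot u v.
Proof. by rewrite -scaleN1r hdotZl mulN1r. Qed.

Lemma hdotNr u v : hdot u (- v) = - hdot u v.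
Proof. by rewrite -scaleN1r hdotZr rmorphN1 mulN1r. Qed.

Lemma hdotBl u v w : hdot (u - v) w = hdot u w - hdot v w.
Proof. by rewrite hdotDl hdotNl. Qed.

Lemma hdotBr u v w : hdot w (u - v) = hdot w u - hdot w v.
Proof. by rewrite hdotDr hdotNr. Qed.

Lemma hdot0l u : hdot 0 u = 0.
Proof. by rewrite -(scale0r 0) hdotZl mul0r. Qed.

Lemma hdot0r u : hdot u 0 = 0.
Proof. by rewrite -(scale0r 0) hdotZr rmorph0 mul0r. Qed.

Lemma hdotC u v : hdot u v = Num.conj (hdot v u).
Proof. exact: dot_conj. Qed.

Lemma hdot_inj u v : (forall w, hdot u w = hdot v w) -> u = v.
Proof.
move=> uv; apply/eqP; rewrite -subr_eq0 -normr_eq0 -sqrf_eq0 -hdotxx.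
by rewrite hdotBl uv subrr.
Qed.

Lemma CauchySchwarz u v : `|hdot u v| <= `|u| * `|v|.
Proof.
apply: le_trans (dot_CauchySchwarz _ _ _) _.
by rewrite !hdotxx !sqrCK.
Qed.

End InnerProduct.

Section Adjoint.
Variables (R : realType) (H K : hilbertType R) (f : H -> K) (g : K -> H).
Hypothesis fg : forall u v, hdot (f u) v = hdot u (g v).

(** Inner products separate vectors, so having an adjoint already forces linearity; hence [adjop]
    stores an adjoint and a bound, and linearity is derived. *)
Lemma adjoint_additive u v : f (u + v) = f u + f v.
Proof. by apply: hdot_inj => w; rewrite fg !hdotDl !fg. Qed.

Lemma adjoint_scalable c u : f (c *: u) = c *: f u.
Proof. by apply: hdot_inj => w; rewrite fg !hdotZl !fg. Qed.

Lemma adjoint_sym u v : hdot (g u) v = hdot u (f v).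
Proof. by rewrite hdotC -fg -hdotC. Qed.

Lemma adjoint_bounded c : 0 <= c -> (forall u, `|f u| <= c * `|u|) ->
  forall v, `|g v| <= c * `|v|.
Proof.
move=> c0 fc v; have [->|gv0] := eqVneq (g v) 0.
  by rewrite normr0 mulr_ge0.
have gv_gt0 : 0 < `|g v| by rewrite normr_gt0.
rewrite -(ler_pM2l gv_gt0) -expr2 -hdotxx -fg mulrCA mulrA.
rewrite -[leLHS]ger0_norm; last by rewrite fg hdotxx exprn_ge0.
apply: le_trans (CauchySchwarz _ _) _.
by rewrite ler_wpM2r.
Qed.

Lemma adjoint_continuous c : 0 <= c -> (forall u, `|f u| <= c * `|u|) ->
  continuous f.
Proof.
move=> c0 fc u; apply/(@cvgrPdist_lt _ _ _ (nbhs u)) => e e0.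
have c1 : 0 < c + 1 by rewrite ltr_wpDl.
apply/nbhs_normP; exists (e / (c + 1)); first exact: divr_gt0.
move=> v /= uv.
have -> : f u - f v = f (u - v).
  by rewrite -scaleN1r -adjoint_scalable -adjoint_additive scaleN1r.
apply: le_lt_trans (fc _) _; apply: (@le_lt_trans _ _ ((c + 1) * `|u - v|)).
  by rewrite ler_wpM2r // lerDl.
by rewrite mulrC -ltr_pdivlMr.
Qed.

End Adjoint.

(* Operators carry their adjoint; [adjop_eq] shows that it is determined. *)
Record adjop (R : realType) (H : hilbertType R) := Adjop {
  adjop_fun :> H -> H;
  adjop_adj : H -> H;
  adjopP : adjoint adjop_fun adjop_adj;
  adjop_bound :
    exists2 c : R[i], 0 <= c & forall u, `|adjop_fun u| <= c * `|u|
}.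

Section OperatorAlgebra.
Variables (R : realType) (H : hilbertType R).
Local Notation C := R[i].
Local Notation A := (adjop H).
Implicit Types (x y z : A) (u v : H) (c : C).

Lemma adjop_eq x y : x =1 y -> x = y.
Proof.
case: x y => [f f' ff' fc] [g g' gg' gc] /= /funext fg; subst g.
have /funext fg' : f' =1 g'.
  move=> v; apply: hdot_inj => w.
  by rewrite (adjoint_sym ff') (adjoint_sym gg').
subst g'; congr Adjop; exact: Prop_irrelevance.
Qed.

HB.instance Definition _ := gen_eqMixin A.
HB.instance Definition _ := gen_choiceMixin A.

Lemma opD x u v : x (u + v) = x u + x v.
Proof. exact: (adjoint_additive (adjopP x)). Qed.

Lemma opZ x c u : x (c *: u) = c *: x u.
Proof. exact: (adjoint_scalable (adjopP x)). Qed.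

Lemma opN x u : x (- u) = - x u.
Proof. by rewrite -scaleN1r opZ scaleN1r. Qed.

Lemma opB x u v : x (u - v) = x u - x v.
Proof. by rewrite opD opN. Qed.

Lemma op0 x : x 0 = 0.
Proof. by rewrite -[X in x X](scale0r 0) opZ scale0r. Qed.

Lemma op_continuous x : continuous x.
Proof.
have [c c0 xc] := adjop_bound x.
exact: (adjoint_continuous (adjopP x) c0 xc).
Qed.

Lemma star_subproof x : adjoint (adjop_adj x) x.
Proof. by move=> u v; rewrite (adjoint_sym (adjopP x)). Qed.

Lemma star_bound x :
  exists2 c : C, 0 <= c & forall u, `|adjop_adj x u| <= c * `|u|.
Proof.
have [c c0 xc] := adjop_bound x; exists c => //.
exact: (adjoint_bounded (adjopP x) c0 xc).
Qed.

Definition star x : A := Adjop (@star_subproof x) (star_bound x).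

Lemma hdot_star x u v : hdot (x u) v = hdot u (star x v).
Proof. exact: adjopP. Qed.

Lemma hdot_starl x u v : hdot (star x u) v = hdot u (x v).
Proof. exact: star_subproof. Qed.

Fact add_adjoint x y :
  adjoint (fun u => x u + y u) (fun u => star x u + star y u).
Proof. by move=> u v; rewrite hdotDl hdotDr !hdot_star. Qed.

Fact add_bound x y :
  exists2 c : C, 0 <= c & forall u, `|x u + y u| <= c * `|u|.
Proof.
have [c c0 xc] := adjop_bound x; have [d d0 yd] := adjop_bound y.
exists (c + d) => [|u]; first exact: addr_ge0.
by rewrite mulrDl (le_trans (ler_normD _ _)) // lerD.
Qed.

Definition op_add x y : A := Adjop (@add_adjoint x y) (add_bound x y).

Fact scale_adjoint c x :
  adjoint (fun u => c *: x u) (fun u => Num.conj c *: star x u).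
Proof. by move=> u v; rewrite hdotZl hdotZr conjCK hdot_star. Qed.

Fact scale_bound c x :
  exists2 d : C, 0 <= d & forall u, `|c *: x u| <= d * `|u|.
Proof.
have [d d0 xd] := adjop_bound x.
exists (`|c| * d) => [|u]; first exact: mulr_ge0.
by rewrite normrZ -mulrA ler_wpM2l.
Qed.

Definition op_scale c x : A := Adjop (@scale_adjoint c x) (scale_bound c x).

Fact mul_adjoint x y : adjoint (x \o y) (star y \o star x).
Proof. by move=> u v; rewrite /= !hdot_star. Qed.

Fact mul_bound x y :
  exists2 c : C, 0 <= c & forall u, `|(x \o y) u| <= c * `|u|.
Proof.
have [c c0 xc] := adjop_bound x; have [d d0 yd] := adjop_bound y.
exists (c * d) => [|u /=]; first exact: mulr_ge0.
by rewrite (le_trans (xc _)) // -mulrA ler_wpM2l.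
Qed.

Definition op_mul x y : A := Adjop (@mul_adjoint x y) (mul_bound x y).

Fact id_adjoint : adjoint (@id H) id.
Proof. by []. Qed.

Fact id_bound :
  exists2 c : C, 0 <= c & forall u : H, `|u| <= c * `|u|.
Proof. by exists 1 => // u; rewrite mul1r. Qed.

Definition op_one : A := Adjop id_adjoint id_bound.

Definition op_opp x := op_scale (-1) x.
Definition op_zero := op_scale 0 op_one.

Fact op_addA : associative op_add.
Proof. by move=> x y z; apply: adjop_eq => u /=; rewrite addrA. Qed.
Fact op_addC : commutative op_add.
Proof. by move=> x y; apply: adjop_eq => u /=; rewrite addrC. Qed.
Fact op_add0 : left_id op_zero op_add.
Proof. by move=> x; apply: adjop_eq => u /=; rewrite scale0r add0r. Qed.
Fact op_addN : left_inverse op_zero op_opp op_add.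
Proof.
by move=> x; apply: adjop_eq => u /=; rewrite scaleN1r scale0r addNr.
Qed.

HB.instance Definition _ :=
  GRing.isZmodule.Build A op_addA op_addC op_add0 op_addN.

Fact op_mulA : associative op_mul.
Proof. by move=> x y z; apply: adjop_eq. Qed.
Fact op_mul1 : left_id op_one op_mul.
Proof. by move=> x; apply: adjop_eq. Qed.
Fact op_mulr1 : right_id op_one op_mul.
Proof. by move=> x; apply: adjop_eq. Qed.
Fact op_mulDl : left_distributive op_mul op_add.
Proof. by move=> x y z; apply: adjop_eq. Qed.
Fact op_mulDr : right_distributive op_mul op_add.
Proof. by move=> x y z; apply: adjop_eq => u /=; rewrite opD. Qed.

HB.instance Definition _ := GRing.Zmodule_isPzRing.Build A
  op_mulA op_mul1 op_mulr1 op_mulDl op_mulDr.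

Fact op_scaleA c d x : op_scale c (op_scale d x) = op_scale (c * d) x.
Proof. by apply: adjop_eq => u /=; rewrite scalerA. Qed.
Fact op_scale1 : left_id 1 op_scale.
Proof. by move=> x; apply: adjop_eq => u /=; rewrite scale1r. Qed.
Fact op_scaleDr : right_distributive op_scale op_add.
Proof. by move=> c x y; apply: adjop_eq => u /=; rewrite scalerDr. Qed.
Fact op_scaleDl x c d :
  op_scale (c + d) x = op_add (op_scale c x) (op_scale d x).
Proof. by apply: adjop_eq => u /=; rewrite scalerDl. Qed.

HB.instance Definition _ := GRing.Zmodule_isLmodule.Build C A
  op_scaleA op_scale1 op_scaleDr op_scaleDl.

Lemma addE x y u : (x + y) u = x u + y u. Proof. by []. Qed.
Lemma mulE x y u : (x * y) u = x (y u). Proof. by []. Qed.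
Lemma scaleE c x u : (c *: x) u = c *: x u. Proof. by []. Qed.
Lemma oppE x u : (- x) u = - x u. Proof. exact: scaleN1r. Qed.
Lemma subE x y u : (x - y) u = x u - y u. Proof. by rewrite -oppE. Qed.
Lemma zeroE u : (0 : A) u = 0. Proof. exact: scale0r. Qed.
Lemma mulZl c x y : (c *: x) * y = c *: (x * y).
Proof. exact: adjop_eq. Qed.

Lemma mulZr c x y : x * (c *: y) = c *: (x * y).
Proof. by apply: adjop_eq => u; rewrite mulE !scaleE opZ. Qed.

Lemma starK : involutive star.
Proof. by move=> x; apply: adjop_eq. Qed.

Lemma starD x y : star (x + y) = star x + star y.
Proof. exact: adjop_eq. Qed.

Lemma starM x y : star (x * y) = star y * star x.
Proof. exact: adjop_eq. Qed.

Lemma starZ c x : star (c *: x) = Num.conj c *: star x.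
Proof. exact: adjop_eq. Qed.

Lemma star1 : star 1 = 1.
Proof. exact: adjop_eq. Qed.

Lemma starN x : star (- x) = - star x.
Proof. by rewrite -scaleN1r starZ rmorphN1 scaleN1r. Qed.

Lemma starB x y : star (x - y) = star x - star y.
Proof. by rewrite starD starN. Qed.

Lemma star0 : star 0 = 0.
Proof. by rewrite -[X in star X](subrr 0) starB subrr. Qed.

Lemma hdot_starM x u : hdot ((star x * x) u) u = `|x u| ^+ 2.
Proof. by rewrite mulE hdot_starl hdotxx. Qed.

Lemma star_mul_eq0 x : star x * x = 0 -> x = 0.
Proof.
move=> xx; apply: adjop_eq => u; rewrite zeroE; apply/eqP.
by rewrite -normr_eq0 -sqrf_eq0 -hdot_starM xx zeroE hdot0l.
Qed.

Lemma star_eq0 x : star x = 0 -> x = 0.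
Proof. by move=> x0; rewrite -[x]starK x0 star0. Qed.

Definition is_proj x := x * x = x /\ star x = x.

Lemma starM_idem x : star x * x = x -> is_proj x.
Proof.
move=> xx; have sx : star x = x by rewrite -xx starM starK.
by split=> //; rewrite -{1}sx.
Qed.

End OperatorAlgebra.

(** * Strong limits *)

Section Convergence.
Variables (R : realType) (H : hilbertType R).
Local Notation C := R[i].
Local Notation A := (adjop H).
Implicit Types (x y : A) (u v : H).

Lemma cvg_hdotl (T : Type) (F : set_system T) (f : T -> H) u v :
  Filter F -> f @ F --> u -> (fun t => hdot (f t) v : C^o) @ F --> (hdot u v : C^o).
Proof.
move=> FF /cvgrPdist_le fu; apply/cvgrPdist_le => e e0.
have v1 : 0 < `|v| + 1 by rewrite ltr_wpDl.
have := fu _ (divr_gt0 e0 v1); apply: filterS => t ft.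
rewrite -hdotBl; apply: le_trans (CauchySchwarz _ _) _.
apply: (@le_trans _ _ (`|u - f t| * (`|v| + 1))).
  by rewrite ler_wpM2l // lerDl.
by rewrite -ler_pdivlMr.
Qed.

Lemma norm_cvg_le (T : Type) (F : set_system T) (f g : T -> H) u v :
  ProperFilter F -> (forall t, `|f t| <= `|g t|) ->
  f @ F --> u -> g @ F --> v -> `|u| <= `|v|.
Proof.
move=> FF fg /cvgrPdist_le fu /cvgrPdist_le gv; apply/ler_addgt0Pr => e e0.
have e2 : 0 < e / 2 by rewrite divr_gt0.
have [t [ft gt]] := filter_ex (filterI (fu _ e2) (gv _ e2)).
have := le_trans (lerB_dist u (f t)) ft; rewrite lerBlDr => /le_trans; apply.
have := le_trans (lerB_dist (g t) v); rewrite distrC => /(_ _ gt).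
rewrite lerBlDl => gv2; rewrite addrC [leRHS](_ : _ = `|v| + e / 2 + e / 2) ?lerD2r.
  exact: le_trans (fg t) gv2.
by rewrite -addrA -splitr.
Qed.

(** Norms of vectors take values in [R[i]]; their squares are brought back to [R], where bounded
    monotone sequences converge. *)
Definition sqn u : R := complex.Re (`|u| ^+ 2).

Lemma sqnE u : (sqn u)%:C = `|u| ^+ 2.
Proof. by rewrite /sqn RRe_real // rpredX // normr_real. Qed.

Lemma sqn_ge0 u : 0 <= sqn u.
Proof. by rewrite -ler0c sqnE exprn_ge0. Qed.

(** The hypothesis makes [d] nondecreasing, so [d] converges and its increments force [u] to be
    Cauchy. It is applied with [d] the squared norm of [u] itself, to Newton's iterates and to
    increasing chains of partial isometries. *)
Lemma mono_cvg (u : nat -> H) (d : nat -> R) (b : R) :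
  (forall k m, (k <= m)%N -> `|u m - u k| ^+ 2 <= (d m - d k)%:C) ->
  (forall n, d n <= b) -> cvg (u @ \oo).
Proof.
move=> ud db.
have d_nd : nondecreasing_seq d.
  by move=> k m km; rewrite -subr_ge0 -ler0c (le_trans _ (ud _ _ km)) ?exprn_ge0.
have d_ub : has_ubound (range d) by exists b => _ [n _ <-].
have dl := nondecreasing_cvgn d_nd d_ub.
have dle := nondecreasing_cvgn_le d_nd (cvgP _ dl).
rewrite (cvg_lim _ dl) // in dle.
apply: cauchy_cvg; apply: cauchy_exP => e e0.
have [r r0 re] : exists2 r : R, 0 < r & e = r%:C.
  have er : e \is Num.real by exact: gtr0_real.
  exists (complex.Re e); last by rewrite RRe_real.
  by rewrite -ltcR RRe_real.
have r2 : 0 < r ^+ 2 / 2 by rewrite divr_gt0 // exprn_gt0.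
have /cvgrPdist_le/(_ _ r2) [N _ NP] := dl.
exists (u N); exists N => // m /= Nm; rewrite -ball_normE /=.
rewrite distrC -ltr_sqr ?nnegrE ?normr_ge0 ?(ltW e0) //.
apply: le_lt_trans (ud _ _ Nm) _.
rewrite re -rmorphXn /= ltcR.
have := NP N (leqnn N); rewrite ler_norml => /andP[_].
have := dle m; rewrite expr2; nra.
Qed.

Definition contraction x := forall u, `|x u| <= `|u|.

Lemma contraction_star x : contraction x -> contraction (star x).
Proof.
move=> cx u; rewrite -[leRHS]mul1r; apply: (adjoint_bounded (adjopP x) ler01).
by move=> v; rewrite mul1r.
Qed.

(** A uniform bound makes the product jointly continuous along strongly convergent sequences, which
    lets limits pass through expressions such as [v * star v * v]. *)
Lemma contraction_cvg (x : nat -> A) y (v : nat -> H) u :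
  (forall n, contraction (x n)) -> (forall w, x n w @[n --> \oo] --> y w) ->
  v n @[n --> \oo] --> u -> x n (v n) @[n --> \oo] --> y u.
Proof.
move=> cx xy /cvgrPdist_le vu; apply/cvgrPdist_le => e e0.
have e2 : 0 < e / 2 by rewrite divr_gt0.
have /cvgrPdist_le/(_ _ e2) := xy u.
apply: filterS2 (vu _ e2) => n vn xn.
have -> : y u - x n (v n) = (y u - x n u) + x n (u - v n).
  by rewrite opB addrA subrK.
rewrite (splitr e) (le_trans (ler_normD _ _)) // lerD //.
by rewrite (le_trans (cx _ _)).
Qed.

(** Strong convergence does not pass to adjoints, so both sequences are assumed to converge; the
    limits are adjoint to each other because inner products converge. *)
Lemma sot_limit (x : nat -> A) : (forall n, contraction (x n)) ->
  (forall u, cvg (x n u @[n --> \oo])) ->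
  (forall u, cvg (star (x n) u @[n --> \oo])) ->
  exists y, (forall u, x n u @[n --> \oo] --> y u) /\
            (forall u, star (x n) u @[n --> \oo] --> star y u).
Proof.
move=> cx cvx cvs.
pose f u := lim (x n u @[n --> \oo]); pose g u := lim (star (x n) u @[n --> \oo]).
have fg : adjoint f g.
  move=> u v.
  have xf : (fun n => hdot (x n u) v : C^o) @ \oo --> (hdot (f u) v : C^o).
    exact: cvg_hdotl (cvx u).
  have xg : (fun n => hdot (star (x n) v) u : C^o) @ \oo --> (hdot (g v) u : C^o).
    exact: cvg_hdotl (cvs v).
  rewrite [RHS]hdotC; apply/eqP; rewrite -subr_eq0 -normr_le0; apply/ler_addgt0Pr.
  move=> e e0; rewrite add0r; have e2 : 0 < e / 2 by rewrite divr_gt0.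
  have /cvgrPdist_le/(_ _ e2) xf2 := xf.
  have /cvgrPdist_le/(_ _ e2) xg2 := xg.
  have [n [fn gn]] := filter_ex (filterI xf2 xg2).
  rewrite -(subrK (hdot (x n u) v) (hdot (f u) v)) -addrA (splitr e).
  rewrite (le_trans (ler_normD _ _)) // lerD //.
  by rewrite hdot_star [hdot u _]hdotC -rmorphB /= norm_conjC distrC.
have fb u : `|f u| <= 1 * `|u|.
  rewrite mul1r; apply: norm_cvg_le (cvx u) (cvg_cst u) => n; exact: cx.
have fb' : exists2 c : C, 0 <= c & forall u, `|f u| <= c * `|u| by exists 1.
by exists (Adjop fg fb'); split=> u; [exact: cvx | exact: cvs].
Qed.

End Convergence.

(** * Polar decomposition *)

Section Newton.
Variables (R : realType) (H : hilbertType R).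
Local Notation C := R[i].
Local Notation A := (adjop H).
Implicit Types (x y a p q : A) (u v : H).

Definition positive p := forall u, 0 <= hdot (p u) u.

(* The polynomials in [a] generated by [a] and [1 - a], which are positive as
   soon as [0 <= a <= 1]. *)
Inductive cone a : A -> Prop :=
| cone_mono i j : cone a (a ^+ i * (1 - a) ^+ j)
| cone_add p q : cone a p -> cone a q -> cone a (p + q)
| cone_scale (r : R) p : 0 <= r -> cone a p -> cone a (r%:C *: p).

Lemma comm_compl a i j : a ^+ i * (1 - a) ^+ j = (1 - a) ^+ j * a ^+ i.
Proof.
apply: commrX; apply: commr_sym; apply: commrX.
by apply: commr_sym; apply: commrB => //; exact: commr1.
Qed.

Lemma cone1 a : cone a 1.
Proof. by have := cone_mono a 0 0; rewrite !expr0 mulr1. Qed.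

Lemma cone_base a : cone a a.
Proof. by have := cone_mono a 1 0; rewrite expr1 mulr1. Qed.

Lemma cone_compl a : cone a (1 - a).
Proof. by have := cone_mono a 0 1; rewrite expr1 mul1r. Qed.

Lemma cone_mul a p q : cone a p -> cone a q -> cone a (p * q).
Proof.
move=> ap aq; elim: ap => [i j|r s _ rq _ sq|r s r0 _ sq].
- elim: aq => [k l|r s _ r1 _ s1|r s r0 _ s1].
  + rewrite -mulrA [X in _ * X]mulrA.
    by rewrite -comm_compl -mulrA mulrA -!exprD; exact: cone_mono.
  + by rewrite mulrDr; exact: cone_add.
  + by rewrite mulZr; exact: cone_scale.
- by rewrite mulrDl; exact: cone_add.
- by rewrite mulZl; exact: cone_scale.
Qed.

Lemma cone_half a p : cone a p -> cone a ((2^-1)%:C *: p).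
Proof. by apply: cone_scale; rewrite invr_ge0. Qed.

Lemma starX p n : star (p ^+ n) = star p ^+ n.
Proof. by elim: n => [|n IHn]; rewrite ?star1 // exprS starM IHn -exprSr. Qed.

Lemma cone_star a p : star a = a -> cone a p -> star p = p.
Proof.
move=> sa; have sb : star (1 - a) = 1 - a by rewrite starB star1 sa.
elim=> [i j|q r _ sq _ sr|r q _ _ sq].
- by rewrite starM !starX sa sb comm_compl.
- by rewrite starD sq sr.
- by rewrite starZ sq (CrealP _) // complex_real.
Qed.

Lemma contractionP x : contraction x -> forall u, sqn (x u) <= sqn u.
Proof. by move=> cx u; rewrite -lecR !sqnE ler_sqr ?nnegrE // cx. Qed.

Lemma contraction_sq x : contraction x <-> positive (1 - star x * x).
Proof.
have xE u : hdot ((1 - star x * x) u) u = `|u| ^+ 2 - `|x u| ^+ 2.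
  by rewrite subE hdotBl hdotxx hdot_starM.
split=> [cx u|px u]; first by rewrite xE subr_ge0 ler_sqr ?nnegrE // cx.
by have := px u; rewrite xE subr_ge0 ler_sqr ?nnegrE.
Qed.

(** Splitting exponents into halves and parities writes a monomial as [c * m * c] with [c]
    self-adjoint and [m] one of [1], [a], [1 - a], [a * (1 - a)]. The last is positive because
    [star x] is a contraction too: its form at [w] is [|x w|^2 - |star x (x w)|^2]. *)
Lemma cone_positive x p : contraction x -> cone (star x * x) p -> positive p.
Proof.
move=> cx; have [b b_def] : {b | b = 1 - star x * x} by exists (1 - star x * x).
set a := star x * x.
have sa : star a = a by rewrite /a starM starK.
elim=> [i j u|q r _ q0 _ r0 u|r q r0 _ q0 u]; last 2 first.
- by rewrite addE hdotDl addr_ge0.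
- by rewrite scaleE hdotZl mulr_ge0 // ler0c.
have sb : star (1 - a) = 1 - a by rewrite starB star1 sa.
pose c := a ^+ i./2 * (1 - a) ^+ j./2.
have sc : star c = c by rewrite /c starM !starX sa sb comm_compl.
have -> : a ^+ i * (1 - a) ^+ j = c * (a ^+ odd i * (1 - a) ^+ odd j) * c.
  have gen y z s t : z * y = y * z -> y * t = t * y -> s * z = z * s ->
      s * t = t * s -> s * y = y * s ->
      z * (y * y) * (t * (s * s)) = y * s * (z * t) * (y * s).
    move=> zy yt sz st sy; rewrite !mulrA zy -(mulrA _ y t) yt !mulrA.
    rewrite -(mulrA y s z) sz !mulrA -(mulrA _ s t) st !mulrA.
    by rewrite -(mulrA _ s y) sy !mulrA.
  rewrite -{1}(odd_double_half i) -{1}(odd_double_half j) -!addnn !exprD /c.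
  apply: gen; rewrite ?comm_compl //.
    by rewrite -!exprD addnC.
  by rewrite -!exprD addnC.
rewrite -mulrA mulE -{1}sc hdot_starl mulE; set w := c u.
have b0 : positive (1 - a) by apply/contraction_sq.
case: (odd i) (odd j) => -[]; rewrite ?(expr0, expr1, mul1r, mulr1) //.
- have -> : hdot ((a * (1 - a)) w) w = `|x w| ^+ 2 - `|a w| ^+ 2.
    by rewrite mulrBr mulr1 subE hdotBl hdot_starM -{1}sa hdot_starM.
  by rewrite subr_ge0 ler_sqr ?nnegrE // mulE (contraction_star cx).
- by rewrite hdot_starM exprn_ge0.
Qed.

(** Written as [x] times [1 + c], so that the correction [c] visibly lies in the cone. *)
Definition newton x := x * (1 + (2^-1)%:C *: (1 - star x * x)).

(** Since [x * (1 - star x * x) = (1 - x * star x) * x], iterating on [star x] gives the adjoints of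
    the iterates; this yields the convergence of adjoints required by [sot_limit]. *)
Lemma star_newton x : star (newton x) = newton (star x).
Proof.
rewrite /newton starM starD starZ starB star1 starM starK mulrDl mulrDr mul1r mulr1.
rewrite mulZl mulZr mulrBl mulrBr mul1r mulr1 mulrA.
by rewrite (CrealP _) // complex_real.
Qed.

(** With [c = (1 - star x * x) / 2] one has [star x * x = 1 - 2 c], and the new defect is
    [1 - (1 + c)^2 (1 - 2 c) = 3 c^2 + 2 c^3], with nonnegative coefficients. The element [a] is
    kept apart from [x] because the cone of the starting point is used along the whole iteration. *)
Lemma newton_cone a x : star a = a ->
  cone a (star x * x) -> cone a (1 - star x * x) ->
  cone a (star (newton x) * newton x) /\
  cone a (1 - star (newton x) * newton x).
Proof.
move=> sa ax bx; pose c := (2^-1)%:C *: (1 - star x * x).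
have ac : cone a c by exact: cone_half.
have a1c : cone a (1 + c) by apply: cone_add => //; exact: cone1.
have xc : star x * x = 1 - c - c.
  have half2 : 2^-1 + 2^-1 = 1 :> R by lra.
  by rewrite -addrA -opprD -scalerDl -rmorphD /= half2 scale1r subKr.
have nE : star (newton x) * newton x = (1 + c) * ((1 - c - c) * (1 + c)).
  by rewrite /newton starM -/c (cone_star sa a1c) -xc !mulrA.
split.
  by rewrite nE -xc; apply: cone_mul => //; apply: cone_mul.
rewrite nE.
have -> : 1 - (1 + c) * ((1 - c - c) * (1 + c)) =
    c * c + c * c + c * c + (c * c * c + c * c * c).
  have cb : (1 - c - c) * (1 + c) = 1 - c - c * c - c * c.
    rewrite mulrDr mulr1 !mulrBl mul1r -!addrA; congr (_ + _).
    by rewrite !addrA addrNK.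
  suff -> : (1 + c) * ((1 - c - c) * (1 + c)) =
      1 - (c * c + c * c + c * c + (c * c * c + c * c * c)) by rewrite subKr.
  rewrite cb mulrDl mul1r !mulrBr mulr1 !mulrA !opprD !addrA.
  do 3 congr (_ - _).
  by rewrite -(addrA (1 - c)) addrAC subrK addrA.
have acc : cone a (c * c) by exact: cone_mul.
have accc : cone a (c * c * c) by exact: cone_mul.
by do ![apply: cone_add].
Qed.

End Newton.

Section PolarDecomposition.
Variables (R : realType) (H : hilbertType R).
Local Notation C := R[i].
Local Notation A := (adjop H).
Implicit Types (x y a p q v : A) (u w : H).

Local Notation newtons n x := (iter n (@newton R H) x).

Lemma star_newtons n x : star (newtons n x) = newtons n (star x).
Proof. by elim: n => [//|n IHn]; rewrite /= star_newton IHn. Qed.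

Lemma newtons_cone x n :
  cone (star x * x) (star (newtons n x) * newtons n x) /\
  cone (star x * x) (1 - star (newtons n x) * newtons n x).
Proof.
elim: n => [|n [IHa IHb]]; first by split; [exact: cone_base|exact: cone_compl].
by apply: newton_cone => //; rewrite starM starK.
Qed.

Lemma newtons_contraction x n : contraction x -> contraction (newtons n x).
Proof.
by move=> cx; apply/contraction_sq/(cone_positive cx); case: (newtons_cone x n).
Qed.

(** Positivity of [h] gives the monotonicity of the iterates; the factor [x] on the left shows that
    every [q] with [q * x = x] also fixes the iterates. *)
Lemma newtons_factor x n : contraction x ->
  exists2 h, cone (star x * x) h & newtons n x = x * (1 + h).
Proof.
move=> cx; elim: n => [|n [h ah xE]].
  exists 0; last by rewrite addr0 mulr1.
  have -> : (0 : A) = (0 : R)%:C *: (1 : A) by rewrite scale0r.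
  by apply: cone_scale => //; exact: cone1.
have [_ /cone_half] := newtons_cone x n.
rewrite /= /newton; set c := _ *: _ => ac.
exists (h + c + h * c).
  by apply: cone_add; [exact: cone_add|exact: cone_mul].
rewrite xE -mulrA; congr (_ * _).
by rewrite mulrDl mul1r mulrDr mulr1 !addrA (addrAC 1 c).
Qed.

(** After expanding the square, it remains that the inner product of the iterate with [x u] is at
    least [|x u|^2]; the difference is the form of [star x * x * h], an element of the cone. *)
Lemma newtons_mono0 x n u : contraction x ->
  `|newtons n x u - x u| ^+ 2 <= `|newtons n x u| ^+ 2 - `|x u| ^+ 2.
Proof.
move=> cx; have [h ah xE] := newtons_factor n cx.
have hp : 0 <= hdot ((star x * x * h) u) u.
  by apply: (cone_positive cx); apply: cone_mul => //; exact: cone_base.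
have E : hdot (newtons n x u) (x u) = `|x u| ^+ 2 + hdot ((star x * x * h) u) u.
  rewrite -hdot_starl -mulE xE mulrA mulrDr mulr1 addE hdotDl.
  by rewrite hdot_starM.
have E' : hdot (x u) (newtons n x u) = hdot (newtons n x u) (x u).
  rewrite hdotC; apply/CrealP; rewrite E.
  by apply: rpredD; apply: ger0_real => //; exact: exprn_ge0.
rewrite -hdotxx !(hdotBl, hdotBr) E' !hdotxx E.
set q := hdot _ _ in hp *; set s := _ ^+ 2; set t := _ ^+ 2.
have -> : s - (t + q) - (t + q - t) = s - t - (q + q) by ring.
by rewrite lerBlDr lerDl addr_ge0.
Qed.

Lemma newtons_mono x k m u : contraction x -> (k <= m)%N ->
  `|newtons m x u - newtons k x u| ^+ 2 <=
  `|newtons m x u| ^+ 2 - `|newtons k x u| ^+ 2.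
Proof.
move=> cx km; rewrite -(subnK km) iterD; apply: newtons_mono0.
exact: newtons_contraction.
Qed.

Lemma newtons_cvg x u : contraction x -> cvg (newtons n x u @[n --> \oo]).
Proof.
move=> cx; apply: (@mono_cvg _ _ _ (fun n => sqn (newtons n x u)) (sqn u)).
  by move=> k m km; rewrite rmorphB /= !sqnE; exact: newtons_mono.
by move=> n; apply: contractionP; exact: newtons_contraction.
Qed.

(* Newton's iteration moves every singular value in ]0, 1] monotonically to 1
   and fixes the singular value 0. *)
Lemma polar x : contraction x -> exists v,
  [/\ v * star v * v = v,
      forall u, `|x u| <= `|v u|,
      forall u, newtons n x u @[n --> \oo] --> v u &
      forall u, newtons n (star x) u @[n --> \oo] --> star v u].
Proof.
move=> cx; have cn n := newtons_contraction n cx.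
have csx := contraction_star cx.
have [||v [xv sxv]] := @sot_limit _ _ (fun n => newtons n x) cn.
- by move=> u; exact: newtons_cvg.
- move=> u; under eq_fun do rewrite star_newtons; exact: newtons_cvg.
exists v; split=> //; last 1 first.
- by move=> u; have := sxv u; under eq_fun do rewrite star_newtons.
(* The limit is a fixed point of the iteration, and [newton v = v] says
   [v * (1 - star v * v) / 2 = 0], the identity of partial isometries. *)
- have vE : newton v = v.
    apply: adjop_eq => u; apply: (@cvg_unique _ (@norm_hausdorff _ _)
      (newtons n.+1 x u @[n --> \oo])); last first.
      by have := xv u; rewrite -(cvg_shiftS (fun n => newtons n x u)).
    have newtonE y : newton y u =
        y (u + (2^-1)%:C *: (u - star y (y u))).
      by rewrite /newton mulE addE scaleE subE.
    rewrite newtonE.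
    have -> : (fun n => newtons n.+1 x u) = (fun n => newtons n x
        (u + (2^-1)%:C *: (u - star (newtons n x) (newtons n x u)))).
      by apply/funext => n; exact: newtonE.
    apply: (contraction_cvg cn xv).
    apply: cvgD; first exact: cvg_cst.
    apply: cvgZl_tmp; apply: cvgB; first exact: cvg_cst.
    by apply: contraction_cvg sxv (xv u) => n; exact: contraction_star.
  have half0 : (2^-1 : R)%:C != 0.
    by rewrite (inj_eq (@complexI R) _ 0) invr_eq0 pnatr_eq0.
  move: vE; rewrite /newton mulrDr mulr1 mulZr => /eqP.
  rewrite -subr_eq0 addrAC subrr add0r scaler_eq0 (negPf half0) /=.
  by rewrite mulrBr mulr1 subr_eq0 mulrA => /eqP.
- move=> u; apply: norm_cvg_le (cvg_cst (x u)) (xv u) => n.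
  rewrite -ler_sqr ?nnegrE // -subr_ge0 (le_trans _ (newtons_mono0 n u cx)) //.
Qed.

End PolarDecomposition.

(** * Partial isometries and signs inside a strongly closed algebra *)

Section StarAlgebra.
Variables (R : realType) (H : hilbertType R).
Local Notation C := R[i].
Local Notation A := (adjop H).
Implicit Types (x y a b p q e s v : A) (u w : H).
Local Notation newtons n x := (iter n (@newton R H) x).

(** Closure under strong limits of sequences is what Newton's iteration and increasing chains call
    for. The record asks for no unit, so that it also covers ideals. *)
Record star_algebra (M : set A) : Prop := StarAlgebra {
  sa0 : M 0;
  sa_lin : forall (c : C) x y, M x -> M y -> M (c *: x + y);
  saM : forall x y, M x -> M y -> M (x * y);
  sa_star : forall x, M x -> M (star x);
  sa_lim : forall (x : nat -> A) y, (forall n, M (x n)) ->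
    (forall u, x n u @[n --> \oo] --> y u) -> M y
}.

Section Closure.
Variables (M : set A) (MA : star_algebra M).

Lemma unit_proj e : M e -> (forall x, M x -> e * x = x /\ x * e = x) ->
  is_proj e.
Proof.
move=> Me eM; apply: starM_idem; have [_ ee] := eM _ (sa_star MA Me).
by rewrite -[RHS]starK -[in RHS]ee starM starK.
Qed.

Lemma saZ c x : M x -> M (c *: x).
Proof. by move=> Mx; rewrite -[c *: x]addr0; apply: (sa_lin MA) (sa0 MA). Qed.

Lemma saD x y : M x -> M y -> M (x + y).
Proof. by move=> Mx My; rewrite -[x]scale1r; exact: (sa_lin MA). Qed.

Lemma saN x : M x -> M (- x).
Proof. by move=> Mx; rewrite -scaleN1r; exact: saZ. Qed.

Lemma saB x y : M x -> M y -> M (x - y).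
Proof. by move=> Mx My; apply: saD => //; exact: saN. Qed.

Lemma sa_sum I (r : seq I) (P : pred I) (F : I -> A) :
  (forall i, P i -> M (F i)) -> M (\sum_(i <- r | P i) F i).
Proof.
by move=> MF; elim/big_ind : _ => //; [exact: (sa0 MA)|exact: saD].
Qed.

Lemma sa_newtons n x : M x -> M (newtons n x).
Proof.
elim: n => [//|n IHn Mx] /=; have Mn := IHn Mx.
rewrite /newton mulrDr mulr1 mulZr mulrBr mulr1.
apply: saD => //; apply: saZ; apply: saB => //.
by apply: (saM MA) => //; apply: (saM MA) => //; exact: (sa_star MA).
Qed.

End Closure.

Lemma op_cvg_unique (f : nat -> H) u w :
  f @ \oo --> u -> f @ \oo --> w -> u = w.
Proof. exact: (@cvg_unique _ (@norm_hausdorff _ _)). Qed.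

Lemma op_cvg (f : nat -> H) u x : f @ \oo --> u -> x (f n) @[n --> \oo] --> x u.
Proof. by move=> fu; apply: cvg_comp fu _; exact: op_continuous. Qed.

Lemma newtons_mulL x q n : contraction x -> q * x = x ->
  q * newtons n x = newtons n x.
Proof.
by move=> cx qx; have [h _ ->] := newtons_factor n cx; rewrite mulrA qx.
Qed.

Lemma sot_mulL (x : nat -> A) v q : (forall n, q * x n = x n) ->
  (forall u, x n u @[n --> \oo] --> v u) -> q * v = v.
Proof.
move=> qx xv; apply: adjop_eq => u; apply: op_cvg_unique (xv u).
have E : (fun n => q (x n u)) = (fun n => x n u).
  by apply/funext => n; rewrite -mulE qx.
by rewrite -E; exact: op_cvg (xv u).
Qed.

Lemma contraction_scale x : exists2 c : R, 0 < c & contraction (c%:C *: x).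
Proof.
have [d d0 xd] := adjop_bound x.
have d1 : 0 < complex.Re d + 1 by rewrite ltr_wpDl // -ler0c RRe_real // ger0_real.
set k := complex.Re d + 1 in d1; exists k^-1; first by rewrite invr_gt0.
move=> u; rewrite scaleE normrZ ger0_norm; last first.
  by rewrite ler0c invr_ge0 ltW.
have -> : (k^-1)%:C = k%:C^-1 by exact: fmorphV.
rewrite ler_pdivrMl ?ltcR // (le_trans (xd _)) // ler_wpM2r //.
by rewrite rmorphD /= RRe_real ?ger0_real // lerDl.
Qed.

Definition partial_isometry v := v * star v * v = v.

Lemma starMM_pi v : partial_isometry v -> star v * v * star v = star v.
Proof. by move=> vP; rewrite -[in RHS]vP !starM starK mulrA. Qed.

Lemma partial_isometry_star v :
  partial_isometry v -> partial_isometry (star v).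
Proof. by move=> vP; rewrite /partial_isometry starK starMM_pi. Qed.

(** The polar part of a rescaled [x], nonzero because it dominates the rescaled [x] on every vector.
    The last two clauses place it in the same corner as [x]: they hold for the iterates and survive
    the limit, the right-hand one through adjoints. *)
Lemma exists_partial_isometry M x : star_algebra M -> M x -> x != 0 ->
  exists v, [/\ M v, partial_isometry v, v != 0,
    forall q, q * x = x -> q * v = v & forall p, x * p = x -> v * p = v].
Proof.
move=> MA Mx x0; have [c c0 cx] := contraction_scale x.
have cC0 : c%:C != 0 by rewrite (inj_eq (@complexI R) _ 0) gt_eqF.
set y := c%:C *: x in cx; have My : M y by exact: saZ.
have [v [vP yv yv1 yv2]] := polar cx.
have csy := contraction_star cx.
exists v; split=> //.
- by apply: (sa_lim MA) yv1 => n; exact: sa_newtons.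
- apply: contra_neq x0 => v0; apply: adjop_eq => u; rewrite zeroE.
  have := yv u; rewrite v0 zeroE normr0 normr_le0 scaleE scaler_eq0 (negPf cC0).
  by move=> /eqP.
- move=> q qx; apply: sot_mulL yv1 => n; apply: newtons_mulL => //.
  by rewrite mulZr qx.
- move=> p xp; rewrite -[v]starK -[p]starK -starM; congr star.
  apply: sot_mulL yv2 => n; apply: newtons_mulL => //.
  by rewrite -starM mulZl xp.
Qed.

Lemma cvg_ge0 (z : nat -> C) (l : C) :
  (z : nat -> C^o) @ \oo --> (l : C^o) -> (forall n, 0 <= z n) -> 0 <= l.
Proof.
move=> zl z0; have zl' : (fun n => `|z n| : C^o) @ \oo --> (`|l| : C^o).
  apply: (cvg_norm zl).
have E : (fun n => `|z n| : C^o) = z by apply/funext => n; rewrite ger0_norm.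
rewrite E in zl'.
by rewrite (cvg_unique (@norm_hausdorff _ _) zl zl') normr_ge0.
Qed.

(** The polar part of a self-adjoint [b] is its sign, and [b * s] is its modulus, positive as a
    limit of elements proportional to [y * y * (1 + h)] in the cone. It does the work of spectral
    projections for minimal projections. *)
Lemma exists_sign M b : star_algebra M -> M b -> star b = b -> b != 0 ->
  exists s, [/\ [/\ M s, star s = s, s * s * s = s & s != 0],
    positive (b * s), forall q, q * b = b -> q * s = s &
    forall u, b u = 0 -> s u = 0].
Proof.
move=> MA Mb sb b0; have [c c0 cy] := contraction_scale b.
have cC0 : 0 < c%:C by rewrite ltcR.
set y := c%:C *: b in cy; have My : M y by exact: saZ.
have sy : star y = y by rewrite starZ sb (CrealP _) // complex_real.
have [v [vP yv yv1 yv2]] := polar cy.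
have sv : star v = v.
  apply: adjop_eq => u; apply: op_cvg_unique (yv1 u).
  by have := yv2 u; rewrite sy.
have yn n : exists2 h, cone (y * y) h &
    newtons n y = y * (1 + h) /\ newtons n y = (1 + h) * y.
  have [h] := newtons_factor n cy; rewrite sy => yh yE; exists h => //; split=> //.
  have := congr1 (@star R H) yE; rewrite star_newtons starM sy starD star1.
  by rewrite (cone_star _ yh) // starM sy.
exists v; split.
- split=> //.
  + by apply: (sa_lim MA) yv1 => n; exact: sa_newtons.
  + by rewrite -{2}sv.
  + apply: contra_neq b0 => v0; apply: adjop_eq => u; rewrite zeroE.
    have := yv u; rewrite v0 zeroE normr0 normr_le0 scaleE scaler_eq0.
    by rewrite gt_eqF //= => /eqP.
- move=> u; rewrite mulE hdot_star sb.
  apply: (@cvg_ge0 (fun n => hdot (newtons n y u) (b u))).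
    exact: cvg_hdotl (yv1 u).
  move=> n.
  rewrite -(pmulr_rge0 _ cC0); have [h yh [E _]] := yn n.
  have -> : c%:C * hdot (newtons n y u) (b u) = hdot ((y * (y * (1 + h))) u) u.
    by rewrite E [in RHS]mulE [RHS]hdot_star sy scaleE hdotZr (CrealP _) // complex_real.
  rewrite -{1}sy mulrA; apply: (cone_positive cy); rewrite sy.
  by apply: cone_mul; [exact: cone_base|apply: cone_add => //; exact: cone1].
- move=> q qb; apply: sot_mulL yv1 => n; apply: newtons_mulL => //.
  by rewrite mulZr qb.
- move=> u bu; apply: op_cvg_unique (yv1 u) _.
  have E : (fun n => newtons n y u) = (fun=> 0).
    apply/funext => n; have [h _ [_ ->]] := yn n.
    by rewrite mulE scaleE bu scaler0 op0.
  by rewrite E; exact: cvg_cst.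
Qed.

(** Positivity is tested at [u - t b u]: the form has no constant term in [t], so for small [t > 0]
    the linear term [- 2 t |b u|^2] would dominate. *)
Lemma positive_ker b u : star b = b -> positive b -> hdot (b u) u = 0 -> b u = 0.
Proof.
move=> sb pb bu; set w := b u.
have [k kE] : exists k : R, hdot (b w) w = k%:C.
  by exists (complex.Re (hdot (b w) w)); rewrite RRe_real // ger0_real.
have wE : hdot (b w) u = (sqn w)%:C by rewrite hdot_star sb sqnE -hdotxx.
have : forall t : R, 0 < t -> 2 * sqn w <= t * k.
  move=> t t0; have := pb (u - t%:C *: w).
  rewrite opB opZ !(hdotBl, hdotBr) !(hdotZl, hdotZr) bu -/w kE wE hdotxx -sqnE.
  rewrite (CrealP _) ?complex_real // -!rmorphM sub0r -rmorphN -!rmorphB /= ler0c.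
  move=> h; have : 0 <= t * (t * k - 2 * sqn w) by lra.
  by rewrite pmulr_rge0 // subr_ge0.
have w0 := sqn_ge0 w; have k0 : 0 <= k by rewrite -ler0c -kE; exact: pb.
(* For this value of [t], [t * k] is smaller than [sqn w] unless [w] vanishes. *)
move=> /(_ (sqn w / (k + 1))) h.
apply/eqP; rewrite -normr_eq0 -sqrf_eq0 -sqnE (inj_eq (@complexI R) _ 0).
rewrite eq_le w0 andbT leNgt; apply/negP => w1.
have k1 : 0 < k + 1 by lra.
have := h (divr_gt0 w1 k1); rewrite mulrAC ler_pdivlMr //; nra.
Qed.

End StarAlgebra.

(** * Comparison of projections *)

Section Maximal.
Variables (R : realType) (T : choiceType) (S : set T) (le : T -> T -> Prop).
Variables (phi : T -> R) (b : R).
Hypotheses (le_refl : forall x, S x -> le x x)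
  (le_tr : forall x y z, S x -> S y -> S z -> le x y -> le y z -> le x z)
  (le_chain : forall u : nat -> T, (forall n, S (u n)) ->
    (forall n, le (u n) (u n.+1)) -> exists2 v, S v & forall n, le (u n) v)
  (phi_le : forall x y, S x -> S y -> le x y -> phi x <= phi y)
  (phi_bound : forall x, S x -> phi x <= b).

(* The Brezis-Browder ordering principle. *)
Lemma exists_maximal x0 : S x0 ->
  exists2 v, S v & forall w, S w -> le v w -> phi w <= phi v.
Proof.
move=> Sx0.
(* The successor of [x] realises at least half of the gain still available above [x]. *)
have step x : S x -> exists y, [/\ S y, le x y &
    forall z, S z -> le x z -> phi z - phi x <= 2 * (phi y - phi x)].
  move=> Sx; pose E := [set phi z | z in [set z | S z /\ le x z]].
  have E0 : has_sup E.
    split; first by exists (phi x), x => //; split=> //; exact: le_refl.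
    by exists b => _ [z [Sz _] <-]; exact: phi_bound.
  have Eub z : S z -> le x z -> phi z <= sup E.
    by move=> Sz xz; apply: sup_upper_bound => //; exists z.
  have [s_le|s_gt] := leP (sup E) (phi x).
    exists x; split=> //; first exact: le_refl.
    by move=> z Sz xz; have := Eub z Sz xz; lra.
  have s2 : 0 < (sup E - phi x) / 2 by lra.
  have [_ [y [Sy xy] <-] ye] := sup_adherent s2 E0.
  by exists y; split=> // z Sz xz; have := Eub z Sz xz; lra.
pose F x : T := if pselect (S x) is left Sx then projT1 (cid (step x Sx)) else x.
have FP x : S x -> [/\ S (F x), le x (F x) &
    forall z, S z -> le x z -> phi z - phi x <= 2 * (phi (F x) - phi x)].
  by move=> Sx; rewrite /F; case: pselect => // Sx'; case: cid.
pose u n := iter n F x0.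
have Su n : S (u n) by elim: n => //= n /FP[].
have uS n : le (u n) (u n.+1) by have [_] := FP _ (Su n).
have [v Sv uv] := le_chain Su uS.
exists v => // w Sw vw; rewrite leNgt; apply/negP => vw_lt.
(* A better [w] above [v] lies above every [u n], so every step would have gained at least [d]. *)
pose d := (phi w - phi v) / 2.
have d0 : 0 < d by rewrite /d; lra.
have dn n : phi (u n) + d <= phi (u n.+1).
  have [_ _ /(_ w Sw)] := FP _ (Su n); rewrite -/(u n.+1) => h.
  have := h (le_tr (Su n) Sv Sw (uv n) vw); have := phi_le (Su n) Sv (uv n).
  by rewrite /d; lra.
have dN n : phi (u 0%N) + n%:R * d <= phi (u n).
  elim: n => [|n IHn]; first by rewrite mul0r addr0.
  by have := dn n; rewrite -natr1 mulrDl mul1r; lra.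
have := phi_bound (Su (Num.truncn ((b - phi (u 0%N)) / d)).+1).
have := dN (Num.truncn ((b - phi (u 0%N)) / d)).+1.
have : (b - phi (u 0%N)) / d < (Num.truncn ((b - phi (u 0%N)) / d)).+1%:R.
  exact: truncnS_gt.
by rewrite ltr_pdivrMr //; lra.
Qed.

End Maximal.

Section PartialIsometry.
Variables (R : realType) (H : hilbertType R).
Local Notation C := R[i].
Local Notation A := (adjop H).
Implicit Types (x y a b p q e s v w z : A) (u : H).

Lemma proj_starM p : is_proj p -> star p * p = p.
Proof. by case=> pp sp; rewrite sp. Qed.

Lemma proj_sub p q : is_proj p -> is_proj q -> p * q = q -> is_proj (p - q).
Proof.
move=> [pp sp] [qq sq] pq; have qp : q * p = q by rewrite -sp -{1}sq -starM pq sq.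
split; last by rewrite starB sp sq.
by rewrite mulrBl !mulrBr pp qq pq qp subrr subr0.
Qed.

Lemma proj_add p q : is_proj p -> is_proj q -> p * q = 0 -> is_proj (p + q).
Proof.
move=> [pp sp] [qq sq] pq.
have qp : q * p = 0 by rewrite -sp -sq -starM pq star0.
split; last by rewrite starD sp sq.
by rewrite mulrDl !mulrDr pp qq pq qp addr0 add0r.
Qed.

Lemma pi_initial v : partial_isometry v -> is_proj (star v * v).
Proof.
move=> vP; split; last by rewrite starM starK.
by rewrite mulrA -(mulrA (star v)) -(mulrA (star v)) vP.
Qed.

Lemma pi_final v : partial_isometry v -> is_proj (v * star v).
Proof. by move=> /partial_isometry_star /pi_initial; rewrite starK. Qed.

Lemma proj_pi p : is_proj p -> partial_isometry p.
Proof. by case=> pp sp; rewrite /partial_isometry sp !pp. Qed.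

Lemma pi_contraction v : partial_isometry v -> contraction v.
Proof.
move=> vP; apply/contraction_sq => u; have [qq sq] : is_proj (1 - star v * v).
  apply: proj_sub (pi_initial vP) _; last by rewrite mul1r.
  by split; [rewrite mul1r|rewrite star1].
by rewrite -qq -{1}sq hdot_starM exprn_ge0.
Qed.

(** Extension of partial isometries: [w] agrees with [v] on the initial space of [v], and likewise
    for the adjoints. On projections this is the usual order. *)
Definition pi_le v w := star v * w = star v * v /\ w * star v = v * star v.

Lemma pi_le_refl v : pi_le v v. Proof. by []. Qed.

Lemma pi_le_star v w : pi_le v w -> pi_le (star v) (star w).
Proof.
move=> [vw wv]; split; rewrite starK.
  by have := congr1 (@star R H) wv; rewrite !starM starK.
by have := congr1 (@star R H) vw; rewrite !starM starK.
Qed.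

Lemma pi_le_trans v w z : partial_isometry v ->
  pi_le v w -> pi_le w z -> pi_le v z.
Proof.
have half v' w' z' : partial_isometry v' -> pi_le v' w' -> pi_le w' z' ->
    star v' * z' = star v' * v'.
  move=> vP [vw wv] [wz zw].
  have sv : star v' = star v' * v' * star w'.
    rewrite -[LHS](starMM_pi vP) -!mulrA; congr (_ * _).
    by have := congr1 (@star R H) wv; rewrite !starM !starK.
  rewrite sv -mulrA wz mulrA -sv; exact: vw.
move=> vP vw wz; split; first exact: half vP vw wz.
have := half _ _ _ (partial_isometry_star vP) (pi_le_star vw) (pi_le_star wz).
by rewrite starK => /(congr1 (@star R H)); rewrite !starM !starK.
Qed.

Lemma pi_le_sub v w : pi_le v w ->
  star (w - v) * (w - v) = star w * w - star v * v.
Proof.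
move=> [vw wv]; have wv' : star w * v = star v * v.
  by have := congr1 (@star R H) vw; rewrite !starM starK.
by rewrite starB mulrBl !mulrBr vw wv' subrr subr0.
Qed.

(** By [pi_le_sub] the squared norm of [v m u - v k u] is a difference of squared norms, so
    [mono_cvg] applies to the chain and to its adjoints. This supplies the chain condition of
    [exists_maximal]. *)
Lemma pi_chain M (v : nat -> A) : star_algebra M ->
  (forall n, M (v n)) -> (forall n, partial_isometry (v n)) ->
  (forall n, pi_le (v n) (v n.+1)) ->
  exists w, [/\ M w, partial_isometry w, forall n, pi_le (v n) w,
    forall u, v n u @[n --> \oo] --> w u &
    forall u, star (v n) u @[n --> \oo] --> star w u].
Proof.
move=> MA Mv vP vS; have cv n := pi_contraction (vP n).
have v_le k m : (k <= m)%N -> pi_le (v k) (v m).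
  elim: m => [|m IHm]; first by rewrite leqn0 => /eqP ->; exact: pi_le_refl.
  rewrite leq_eqVlt => /predU1P[->|]; first exact: pi_le_refl.
  by rewrite ltnS => /IHm km; exact: pi_le_trans (vS m).
have cvgv (x : nat -> A) u : (forall n, contraction (x n)) ->
    (forall k m, (k <= m)%N -> pi_le (x k) (x m)) -> cvg (x n u @[n --> \oo]).
  move=> cx x_le; apply: (@mono_cvg _ _ _ (fun n => sqn (x n u)) (sqn u)).
    move=> k m km; rewrite rmorphB /= !sqnE -subE -!hdot_starM.
    by rewrite pi_le_sub ?subE ?hdotBl //; exact: x_le.
  by move=> n; exact: contractionP.
have [||w [vw svw]] := @sot_limit _ _ v cv.
- by move=> u; exact: cvgv.
- move=> u; apply: (cvgv (fun n => star (v n))) => [n|k m km].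
    exact: contraction_star.
  by apply: pi_le_star; exact: v_le.
exists w; split=> //.
- exact: sa_lim MA _ _ Mv vw.
- apply: adjop_eq => u; apply: op_cvg_unique (vw u).
  have E : (fun n => v n u) = (fun n => v n (star (v n) (v n u))).
    by apply/funext => n; rewrite -{1}(vP n).
  rewrite E !mulE; apply: (contraction_cvg cv vw).
  apply: contraction_cvg svw (vw u) => n; exact: contraction_star.
- have half (x : nat -> A) y k : (forall n, (k <= n)%N -> pi_le (x k) (x n)) ->
      (forall u, x n u @[n --> \oo] --> y u) -> star (x k) * y = star (x k) * x k.
    move=> xk xy; apply: adjop_eq => u.
    apply: (@op_cvg_unique _ _ (fun n => (star (x k) * x k) u)); last exact: cvg_cst.
    rewrite mulE; have := @op_cvg _ _ _ _ (star (x k)) (xy u).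
    move=> /cvgrPdist_le h; apply/cvgrPdist_le => e /h.
    apply: filterS2 (nbhs_infty_ge k) => n kn.
    by rewrite -[X in _ - X]mulE (xk n kn).1.
  move=> k; split; first by apply: half vw => n; exact: v_le.
  have := half (fun n => star (v n)) (star w) k.
  rewrite starK => h; have := h _ svw.
  move=> /(_ (fun n kn => pi_le_star (v_le _ _ kn))) /(congr1 (@star R H)).
  by rewrite !starM !starK.
Qed.

End PartialIsometry.

(** * Traces, units of ideals, comparison *)

Section Trace.
Variables (R : realType) (H : hilbertType R).
Local Notation C := R[i].
Local Notation A := (adjop H).
Implicit Types (M : set A) (x y a p q e s u v w z : A).

Lemma pi_add v u : partial_isometry v -> partial_isometry u ->
  star v * u = 0 -> u * star v = 0 -> partial_isometry (v + u) /\ pi_le v (v + u).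
Proof.
move=> vP uP vu uv.
have uv' : star u * v = 0 by rewrite -[v]starK -starM vu star0.
have vu' : v * star u = 0 by rewrite -[v]starK -starM uv star0.
split; last by rewrite /pi_le mulrDr mulrDl vu uv !addr0.
have E : (v + u) * (star v + star u) = v * star v + u * star u.
  by rewrite mulrDl !mulrDr uv vu' addr0 add0r.
rewrite /partial_isometry starD E mulrDl !mulrDr vP uP.
by rewrite -mulrA vu mulr0 addr0 -mulrA uv' mulr0 add0r.
Qed.

(** Real-valued and not normalised, so that the restriction to an ideal and the sum of the diagonal
    traces of a matrix are instances. *)
Record tracial M (tr : A -> R) : Prop := Tracial {
  trD : forall x y, M x -> M y -> tr (x + y) = tr x + tr y;
  tr_ge0 : forall x, M x -> 0 <= tr (star x * x);
  tr_eq0 : forall x, M x -> tr (star x * x) = 0 -> x = 0;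
  trC : forall x y, M x -> M y -> tr (x * y) = tr (y * x)
}.

Section Traced.
Variables (M : set A) (MA : star_algebra M) (tr : A -> R) (Mtr : tracial M tr).

Lemma tr0 : tr 0 = 0.
Proof.
have := trD Mtr (sa0 MA) (sa0 MA); rewrite addr0 => /eqP.
by rewrite -subr_eq0 opprD addrA subrr sub0r oppr_eq0 => /eqP.
Qed.

Lemma trB x y : M x -> M y -> tr (x - y) = tr x - tr y.
Proof.
move=> Mx My; have := trD Mtr (saB MA Mx My) My.
by rewrite subrK => ->; rewrite addrK.
Qed.

Lemma tr_sum I (r : seq I) (P : pred I) (F : I -> A) :
  (forall i, P i -> M (F i)) ->
  tr (\sum_(i <- r | P i) F i) = \sum_(i <- r | P i) tr (F i).
Proof.
move=> MF; elim: r => [|i r IHr]; first by rewrite !big_nil tr0.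
rewrite !big_cons; case: ifP => // Pi; rewrite (trD Mtr) ?IHr //; first exact: MF.
exact: sa_sum.
Qed.

Lemma tr_proj_ge0 p : M p -> is_proj p -> 0 <= tr p.
Proof. by move=> Mp /proj_starM <-; exact: (tr_ge0 Mtr). Qed.

Lemma tr_proj_gt0 p : M p -> is_proj p -> p != 0 -> 0 < tr p.
Proof.
move=> Mp pP p0; rewrite lt_neqAle tr_proj_ge0 // andbT eq_sym.
by apply: contra_neq p0; rewrite -{1}(proj_starM pP); exact: (tr_eq0 Mtr).
Qed.

Lemma tr_proj_le p q : M p -> M q -> is_proj p -> is_proj q -> p * q = q ->
  tr q <= tr p.
Proof.
move=> Mp Mq pP qP pq; rewrite -subr_ge0 -trB //.
by apply: tr_proj_ge0; [exact: saB|exact: proj_sub].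
Qed.

Lemma tr_initial_final v : M v -> tr (star v * v) = tr (v * star v).
Proof. by move=> Mv; apply: (trC Mtr) => //; exact: (sa_star MA). Qed.

(** A projection [z] of maximal trace is a unit: if [x - z * x] were nonzero, the final projection
    of its polar part would be orthogonal to [z], and adding it would increase the trace. *)
Lemma ideal_unit (b : R) : (forall p, M p -> is_proj p -> tr p <= b) ->
  exists z, [/\ M z, is_proj z, forall x, M x -> z * x = x &
    forall x, M x -> x * z = x].
Proof.
move=> tr_b; pose S := [set p : A | M p /\ is_proj p].
have S0 : S 0 by split; [exact: sa0|split; rewrite ?mulr0 ?star0].
have [|||||z [Mz zP] z_max] := @exists_maximal R A S (@pi_le R H) tr b _ _ _ _ _ 0 S0.
- by [].
- by move=> x y z [_ xP] _ _; apply: pi_le_trans; exact: proj_pi.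
- move=> u Su uS.
  have [|||w [Mw wP uw uw1 uw2]] := @pi_chain _ _ M u MA.
  + by move=> n; case: (Su n).
  + by move=> n; apply: proj_pi; case: (Su n).
  + by [].
  + exists w => //; split=> //; split.
      apply: adjop_eq => v; apply: op_cvg_unique (uw1 v).
      have -> : (fun n => u n v) = (fun n => u n (w v)).
        apply/funext => n; have [_ [uu su]] := Su n; have [] := uw n.
        by rewrite su uu -mulE => ->.
      by rewrite mulE; exact: uw1.
    apply: adjop_eq => v; apply: op_cvg_unique (uw1 v).
    have -> : (fun n => u n v) = (fun n => star (u n) v).
      by apply/funext => n; have [_ [_ ->]] := Su n.
    exact: uw2.
- move=> x y [Mx xP] [My yP] [xy _]; apply: tr_proj_le => //.
  have [xx sx] := xP; have [yy sy] := yP.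
  by rewrite -sx -sy -starM -[x in x * y]sx xy sx xx.
- by move=> x [Mx xP]; exact: tr_b.
have [zz sz] := zP.
have zx x : M x -> z * x = x.
  move=> Mx; apply/eqP; rewrite eq_sym -subr_eq0; apply/negPn/negP => x0.
  have My : M (x - z * x) by apply: saB => //; exact: saM.
  have [v [Mv vP v0 vq _]] := exists_partial_isometry MA My x0.
  have zv : z * v = 0.
    have := vq (1 - z).
    rewrite !mulrBl !mul1r mulrBr mulrA zz subrr subr0 => /(_ erefl).
    by move=> /eqP; rewrite subr_eq addrC -subr_eq subrr => /eqP.
  have Mr : M (v * star v) by apply: saM => //; exact: (sa_star MA).
  have rP := pi_final vP.
  have zr : z * (v * star v) = 0 by rewrite mulrA zv mul0r.
  have rz : v * star v * z = 0 by rewrite -mulrA -{1}sz -starM zv star0 mulr0.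
  have Sr : S (z + v * star v) by split; [exact: saD|exact: proj_add].
  have zr_le : pi_le z (z + v * star v).
    by rewrite /pi_le !sz mulrDr mulrDl zr rz !addr0.
  have := z_max _ Sr zr_le; rewrite (trD Mtr) // gerDl leNgt.
  rewrite tr_proj_gt0 //; apply: contra_neq v0 => vv.
  by apply: star_eq0; apply: star_mul_eq0; rewrite starK.
exists z; split=> // x Mx.
by rewrite -[x]starK -{1}sz -starM zx //; exact: sa_star.
Qed.

(* If [v] is a maximal partial isometry from [p] to [q], then a nonzero
   element of [(q - v v^* ) M (p - v^* v)] would allow to extend it. *)
Lemma comparison p q : M p -> M q -> is_proj p -> is_proj q ->
  (forall x y, M x -> M y -> x != 0 -> y != 0 ->
    exists2 m, M m & x * m * y != 0) ->
  exists v, [/\ M v, partial_isometry v, q * v = v, v * p = v &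
    star v * v = p \/ v * star v = q].
Proof.
move=> Mp Mq pP qP prime.
pose S := [set v : A | [/\ M v, partial_isometry v, q * v = v & v * p = v]].
have S0 : S 0.
  by split; rewrite ?mulr0 ?mul0r // /partial_isometry ?mulr0 ?mul0r //; exact: sa0.
have [|||||v [Mv vP qv vp] v_max] :=
    @exists_maximal R A S (@pi_le R H) (fun v => tr (star v * v)) (tr p)
      _ _ _ _ _ 0 S0.
- by [].
- by move=> x y z [_ xP _ _] _ _; exact: pi_le_trans.
- move=> u Su uS.
  have [|||w [Mw wP uw uw1 uw2]] := @pi_chain _ _ M u MA.
  + by move=> n; case: (Su n).
  + by move=> n; case: (Su n).
  + by [].
  + exists w => //; split=> //.
      by apply: sot_mulL uw1 => n; case: (Su n).
    rewrite -[w]starK -[p]starK -starM; congr star.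
    apply: (sot_mulL _ uw2) => n; rewrite -starM.
    by have [_ _ _ ->] := Su n.
- move=> x y [Mx xP _ _] [My yP _ _] xy; rewrite -subr_ge0.
  have Ms := sa_star MA.
  rewrite -trB; [|apply: (saM MA) => //; exact: Ms..].
  by rewrite -pi_le_sub //; apply: (tr_ge0 Mtr); exact: saB.
- move=> x [Mx xP qx xp]; apply: tr_proj_le => //.
  + by apply: (saM MA) => //; exact: (sa_star MA).
  + exact: pi_initial.
  + by rewrite mulrA -{1}pP.2 -starM xp.
have Msv : M (star v) by exact: (sa_star MA).
have pv : p * star v = star v by rewrite -{1}pP.2 -starM vp.
have vq : star v * q = star v by rewrite -{1}qP.2 -starM qv.
exists v; split=> //.
have [/eqP|p0] := eqVneq (p - star v * v) 0.
  by rewrite subr_eq0 => /eqP ->; left.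
have [/eqP|q0] := eqVneq (q - v * star v) 0.
  by rewrite subr_eq0 => /eqP ->; right.
have Mp' : M (p - star v * v) by apply: saB => //; exact: saM.
have Mq' : M (q - v * star v) by apply: saB => //; exact: saM.
have [m Mm x0] := prime _ _ Mq' Mp' q0 p0.
have Mx : M ((q - v * star v) * m * (p - star v * v)).
  by apply: (saM MA) => //; exact: (saM MA).
have [u [Mu uP u0 uq up]] := exists_partial_isometry MA Mx x0.
have p'P : is_proj (p - star v * v).
  by apply: proj_sub => //; [exact: pi_initial|rewrite mulrA pv].
have q'P : is_proj (q - v * star v).
  by apply: proj_sub => //; [exact: pi_final|rewrite mulrA qv].
have {}uq : (q - v * star v) * u = u by apply: uq; rewrite !mulrA q'P.1.
have {}up : u * (p - star v * v) = u by apply: up; rewrite -!mulrA p'P.1.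
have svv := starMM_pi vP.
have vu : star v * u = 0.
  by rewrite -uq mulrA mulrBr vq mulrA svv subrr mul0r.
have uv : u * star v = 0.
  by rewrite -up -mulrA mulrBl pv svv subrr mulr0.
have [vuP vu_le] := pi_add vP uP vu uv.
have Svu : S (v + u).
  split=> //; first exact: saD.
    rewrite mulrDr qv -{1}uq mulrA mulrBr qP.1 mulrA qv; congr (_ + _); exact: uq.
  rewrite mulrDl vp -{1}up -mulrA mulrBl pP.1 -mulrA vp; congr (_ + _); exact: up.
have := v_max _ Svu vu_le.
have uv' : star u * v = 0 by rewrite -[v]starK -starM vu star0.
rewrite starD mulrDl !mulrDr vu uv' addr0 add0r (trD Mtr) ?gerDl; last 2 first.
- by apply: (saM MA) => //; exact: (sa_star MA).
- by apply: (saM MA) => //; exact: (sa_star MA).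
move=> tru; have /(tr_eq0 Mtr Mu) uu : tr (star u * u) = 0.
  by apply/eqP; rewrite eq_le tru (tr_ge0 Mtr).
by rewrite uu eqxx in u0.
Qed.

End Traced.

(* Otherwise the closed ideal of all [x] with [p M x = 0] would have a unit,
   which would be central. *)
Lemma factor_prime M (tr : A -> R) e : star_algebra M -> tracial M tr -> M e ->
  (forall x, M x -> e * x = x /\ x * e = x) ->
  (forall z, M z -> (forall x, M x -> z * x = x * z) ->
    exists c : C, z = c *: e) ->
  forall x y, M x -> M y -> x != 0 -> y != 0 -> exists2 m, M m & x * m * y != 0.
Proof.
move=> MA Mtr Me eM Z p q Mp Mq p0 q0; apply: contrapT => h.
have pq m : M m -> p * m * q = 0.
  by move=> Mm; apply/eqP/negPn/negP => pmq; apply: h; exists m.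
have Ms := sa_star MA; have eP : is_proj e := unit_proj MA Me eM.
(* The second equation, on the adjoint side, makes [J] stable under [star]. *)
pose J := [set x | M x /\ forall m, M m -> p * m * x = 0 /\ x * m * star p = 0].
have JA : star_algebra J.
  split.
  - by split; [exact: sa0|move=> m _; rewrite mulr0 !mul0r].
  - move=> c x y [Mx Jx] [My Jy]; split; first exact: (sa_lin MA).
    move=> m Mm; have [x1 x2] := Jx m Mm; have [y1 y2] := Jy m Mm.
    by rewrite mulrDr mulZr !mulrDl !mulZl x1 x2 y1 y2 scaler0 addr0.
  - move=> x y [Mx Jx] [My Jy]; split; first exact: (saM MA).
    move=> m Mm; have [x1 _] := Jx m Mm; have [_ y2] := Jy m Mm.
    by rewrite mulrA x1 mul0r -!mulrA [y * _]mulrA y2 mulr0.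
  - move=> x [Mx Jx]; split; first exact: Ms.
    move=> m Mm; have [x1 x2] := Jx _ (Ms _ Mm).
    have := congr1 (@star R H) x1; have := congr1 (@star R H) x2.
    by rewrite !starM !starK star0 !mulrA => -> ->.
  - move=> x y Jx xy; split; first by apply: (sa_lim MA) xy => n; case: (Jx n).
    move=> m Mm; split; apply: adjop_eq => u; rewrite zeroE.
      apply: (@op_cvg_unique _ _ (fun n => (p * m) (x n u))); first exact: op_cvg.
      have -> : (fun n => (p * m) (x n u)) = fun=> 0.
        apply/funext => n; have [_ /(_ m Mm) [xn _]] := Jx n.
        by rewrite -mulE xn zeroE.
      exact: cvg_cst.
    apply: op_cvg_unique (xy ((m * star p) u)) _.
    have -> : (fun n => x n ((m * star p) u)) = fun=> 0.
      apply/funext => n; have [_ /(_ m Mm) [_ xn]] := Jx n.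
      by rewrite -mulE mulrA xn zeroE.
    exact: cvg_cst.
have JM x : J x -> M x by case.
have Jtr : tracial J tr.
  split=> [x y /JM + /JM|x /JM|x /JM|x y /JM + /JM]; [exact: trD Mtr _ _|
    exact: tr_ge0 Mtr _|exact: tr_eq0 Mtr _|exact: trC Mtr _ _].
have [|z [[Mz Jz] zP zl zr]] := ideal_unit JA Jtr (b := tr e).
  move=> r /JM Mr rP; apply: (tr_proj_le MA Mtr) => //.
  by have [] := eM r Mr.
(* Both [z * m] and [m * z] lie in [J], so both equal [z * m * z], and [z] is central. *)
have [c zE] : exists c : C, z = c *: e.
  apply: Z => // m Mm.
  have Jzm : J (z * m).
    split=> [|k Mk]; first exact: (saM MA).
    have [z1 _] := Jz k Mk; have [_ z2] := Jz _ (saM MA Mm Mk).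
    by rewrite mulrA z1 mul0r -[z * m * k]mulrA z2.
  have Jmz : J (m * z).
    split=> [|k Mk]; first exact: (saM MA).
    have [z1 _] := Jz _ (saM MA Mk Mm); have [_ z2] := Jz k Mk.
    by rewrite mulrA -[p * k * m]mulrA z1 -!mulrA [z * _]mulrA z2 mulr0.
  by rewrite -(zr _ Jzm) -mulrA zl.
have Jqq : J (q * star q).
  split=> [|m Mm]; first by apply: (saM MA) => //; exact: Ms.
  split; first by rewrite mulrA pq // mul0r.
  have -> : q * star q * m * star p = q * star (p * star m * q).
    by rewrite !starM starK !mulrA.
  by rewrite pq ?star0 ?mulr0 //; exact: Ms.
have qq : z * (q * star q) = q * star q by exact: zl.
(* [J] contains the nonzero element [q * star q], so its unit is a nonzero multiple of [e]; since
   [p * e * z = 0], this forces [p = 0]. *)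
have c0 : c != 0.
  apply: contra_neq q0 => c0; apply: star_eq0; apply: star_mul_eq0.
  by rewrite starK -qq zE c0 scale0r mul0r.
have [z1 _] := Jz e Me; move/eqP: p0; apply.
have [_ pe] := eM p Mp; move/eqP: z1.
by rewrite zE mulZr -mulrA eP.1 pe scaler_eq0 (negPf c0) => /eqP.
Qed.

End Trace.

(** * Decomposition into small projections *)

Section Decomposition.
Variables (R : realType) (H : hilbertType R).
Local Notation C := R[i].
Local Notation A := (adjop H).
Implicit Types (x y a b p q e s v w : A) (u : H).

Definition prime_algebra (M : set A) := forall x y, M x -> M y ->
  x != 0 -> y != 0 -> exists2 m, M m & x * m * y != 0.

Variables (M : set A) (MA : star_algebra M) (tr : A -> R) (Mtr : tracial M tr).
Hypothesis Mprime : prime_algebra M.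

(** Induction on an integer above [tr q / tr e]. Comparison with [e] either splits off a full copy
    of [e], lowering the trace by [tr e], or exhausts [q]. Only the last piece may fail to be full,
    whence the extra [tr e]; if [tr e < tr q], the first piece is full, as otherwise [q] would be
    equivalent to a subprojection of [e]. *)
Lemma decomposition e p : M e -> is_proj e -> e != 0 -> M p -> is_proj p ->
  exists s : seq A,
  [/\ forall v, v \in s ->
        [/\ M v, partial_isometry v, p * v = v & v * e = v],
      pairwise (fun v w => star v * w == 0) s,
      \sum_(v <- s) v * star v = p,
      (size s)%:R * tr e <= tr p + tr e &
      tr e < tr p -> exists2 v, v \in s & star v * v = e].
Proof.
move=> Me eP e0; have tre := tr_proj_gt0 Mtr Me eP e0.
suff: forall n q, M q -> is_proj q -> tr q < n%:R * tr e -> exists s : seq A,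
  [/\ forall v, v \in s -> [/\ M v, partial_isometry v, q * v = v & v * e = v],
      pairwise (fun v w => star v * w == 0) s,
      \sum_(v <- s) v * star v = q,
      (size s)%:R * tr e <= tr q + tr e &
      tr e < tr q -> exists2 v, v \in s & star v * v = e].
  move=> h Mp pP; apply: (h (Num.truncn (tr p / tr e)).+1) => //.
  by rewrite -ltr_pdivrMr // truncnS_gt.
elim=> [|n IHn] q Mq qP qn.
  by have := tr_proj_ge0 Mtr Mq qP; rewrite leNgt -[X in _ < X](mul0r (tr e)) qn.
have [v [Mv vP qv ve vE]] := comparison MA Mtr Me Mq eP qP Mprime.
have Msv := sa_star MA Mv.
have vf := pi_final vP; have vi := pi_initial vP.
have Mvf : M (v * star v) by exact: (saM MA).
have trv := tr_initial_final MA Mtr Mv.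
have [ve'|/eqP vq] := eqVneq (star v * v) e; last first.
  have {vE} vE : v * star v = q by case: vE.
  exists [:: v]; split=> //=.
  - by move=> w; rewrite inE => /eqP ->.
  - by rewrite big_seq1.
  - by rewrite mul1r lerDr (tr_proj_ge0 Mtr).
  - rewrite ltNge -vE -trv (tr_proj_le MA Mtr) //; first exact: (saM MA).
    by rewrite mulrA -{1}eP.2 -starM ve.
have q'P : is_proj (q - v * star v) by apply: proj_sub => //; rewrite mulrA qv.
have Mq' : M (q - v * star v) by exact: saB.
have trq' : tr (q - v * star v) = tr q - tr e.
  by rewrite (trB MA Mtr) // -trv ve'.
have [|s [sP s_orth s_sum s_size _]] := IHn _ Mq' q'P.
  by rewrite trq' ltrBlDr; move: qn; rewrite -natr1 mulrDl mul1r.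
have svq' : star v * (q - v * star v) = 0.
  rewrite mulrBr -{1}qP.2 -starM qv.
  by rewrite mulrA starMM_pi ?subrr.
have qq' : q * (q - v * star v) = q - v * star v by rewrite mulrBr qP.1 mulrA qv.
exists (v :: s); split=> /=.
- move=> w; rewrite inE => /predU1P[->//|/sP[Mw wP qw we]]; split=> //.
  by rewrite -qw mulrA qq'.
- rewrite s_orth andbT; apply/allP => w /sP[_ _ qw _].
  by rewrite -qw mulrA svq' mul0r.
- by rewrite big_cons s_sum addrC subrK.
- by rewrite -natr1 mulrDl mul1r lerD2r (le_trans s_size) // trq' subrK.
- by move=> _; exists v => //; rewrite inE eqxx.
Qed.

Definition minimal_proj e := [/\ M e, is_proj e, e != 0 &
  forall q, M q -> is_proj q -> e * q = q -> q = 0 \/ q = e].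

(** Subtracting a multiple of [e] gives [b] with zero form at a vector [w] of the range of [e]. If
    [b] is nonzero, its sign [s] satisfies [s * s = e] by minimality, then [s = e] or [s = - e]
    because [(e + s) / 2] is a projection below [e]. So [b] or [- b] is positive, [w] is in the
    kernel of [b], hence of [s], contradicting [s * s = e]. *)
Lemma minimal_scalar_self_adjoint e x : minimal_proj e -> M x -> star x = x ->
  e * x = x -> exists c : C, x = c *: e.
Proof.
move=> [Me eP e0 e_min] Mx sx ex.
have [u w0] : exists u, e u != 0.
  apply: contrapT => h; move/eqP: e0; apply; apply: adjop_eq => u; rewrite zeroE.
  by apply/eqP/negPn/negP => eu; apply: h; exists u.
set w := e u in w0; have ew : e w = w by rewrite /w -mulE eP.1.
have sw0 : 0 < sqn w.
  by rewrite -ltcR sqnE exprn_gt0 // normr_gt0.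
have [r rE] : exists r : R, hdot (x w) w = r%:C.
  exists (complex.Re (hdot (x w) w)); rewrite RRe_real //.
  by apply/CrealP; rewrite -hdotC hdot_star sx.
pose m := r / sqn w; pose b := x - m%:C *: e.
exists m%:C; apply/eqP; rewrite -subr_eq0 -/b; apply/negPn/negP => b0.
have Mb : M b by apply: saB => //; exact: saZ.
have sb : star b = b.
  by rewrite starB starZ sx eP.2 (CrealP _) // complex_real.
have eb : e * b = b by rewrite mulrBr ex mulZr eP.1.
have be : b * e = b by rewrite -sb -{1}eP.2 -starM eb.
have bw : hdot (b w) w = 0.
  rewrite subE hdotBl scaleE ew hdotZl hdotxx -sqnE rE -rmorphM -rmorphB /=.
  by rewrite divfK ?gt_eqF // subrr.
have [s [[Ms ss sss s0] bs es sker]] := exists_sign MA Mb sb b0.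
have {}es : e * s = s by exact: es.
have se : s * e = s by rewrite -ss -{1}eP.2 -starM es.
have s2 : s * s = e.
  have [||//||//] := e_min (s * s).
  - exact: (saM MA).
  - by split; [rewrite -mulrA [s * (s * s)]mulrA sss|rewrite starM ss].
  - by rewrite mulrA es.
  by move=> s20; rewrite -sss s20 mul0r eqxx in s0.
have half : (2^-1)%:C + (2^-1)%:C = 1 :> C.
  by rewrite -rmorphD /=; have -> : 2^-1 + 2^-1 = 1 :> R by lra.
have w0' : s w != 0.
  by apply: contra_neq w0 => sw; rewrite -ew -s2 mulE sw op0.
have [p0|pe] : e + s = 0 \/ e + s = e + e.
  pose p := (2^-1)%:C *: (e + s).
  have pp : p + p = e + s by rewrite -scalerDl half scale1r.
  have pP : is_proj p.
    split; last by rewrite starZ starD eP.2 ss (CrealP _) // complex_real.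
    rewrite mulZl mulZr; congr (_ *: _).
    rewrite mulrDl !mulrDr eP.1 s2 es se [s + e]addrC.
    by rewrite scalerDr -/p pp.
  have [|||p0|pE] := e_min p.
  - by apply: saZ => //; exact: saD.
  - exact: pP.
  - by rewrite mulZr mulrDr eP.1 es.
  - by left; rewrite -pp p0 addr0.
  - by right; rewrite -pp pE.
- have sE : s = - e by apply/eqP; rewrite -addr_eq0 addrC p0.
  have pb : positive (- b) by rewrite -be -mulrN -sE.
  have := @positive_ker _ _ (- b) w; rewrite starN sb => /(_ erefl pb).
  rewrite oppE hdotNl bw oppr0 => /(_ erefl) /eqP; rewrite oppr_eq0 => /eqP /sker sw.
  by rewrite sw eqxx in w0'.
- have sE : s = e by apply: (addrI e).
  have pb : positive b by rewrite -be -sE.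
  by rewrite (sker _ (positive_ker sb pb bw)) eqxx in w0'.
Qed.

Lemma minimal_scalar e x : minimal_proj e -> M x -> e * x = x -> x * e = x ->
  exists c : C, x = c *: e.
Proof.
move=> e_min Mx ex xe; have [Me eP _ _] := e_min; have Msx := sa_star MA Mx.
have esx : e * star x = star x by rewrite -{1}eP.2 -starM xe.
have [|||c cE] := @minimal_scalar_self_adjoint e (x + star x) e_min.
- exact: saD.
- by rewrite starD starK addrC.
- by rewrite mulrDr ex esx.
have [|||d dE] := @minimal_scalar_self_adjoint e ('i *: (x - star x)) e_min.
- by apply: saZ => //; exact: saB.
- by rewrite starZ conjCi starB starK scaleNr -scalerN opprB.
- by rewrite mulZr mulrBr ex esx.
exists (2^-1 * (c - 'i * d)).
rewrite -scalerA scalerBl -cE -scalerA -dE scalerA -expr2 sqrCi scaleN1r opprK.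
rewrite addrACA subrr addr0.
by rewrite -mulr2n -(scaler_nat 2 x) scalerA mulVf ?scale1r // pnatr_eq0.
Qed.

Definition spanned (s : seq A) x :=
  exists c : nat -> C, x = \sum_(i < size s) c i *: s`_i.

Lemma spannedD (s : seq A) x y : spanned s x -> spanned s y -> spanned s (x + y).
Proof.
move=> [c ->] [d ->]; exists (fun i => c i + d i).
by rewrite -big_split; apply: eq_bigr => i _; rewrite scalerDl.
Qed.

Lemma spannedZ (s : seq A) (a : C) x : x \in s -> spanned s (a *: x).
Proof.
move=> xs; have xs' := xs; rewrite -index_mem in xs'.
exists (fun i => if i == index x s then a else 0).
rewrite (bigD1 (Ordinal xs')) //= eqxx nth_index // big1 ?addr0 // => i ix.
by case: ifP => [/eqP E|]; rewrite ?scale0r //; move/eqP: ix; case; exact: val_inj.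
Qed.

Lemma spanned_sum (s : seq A) (I : eqType) (r : seq I) (F : I -> A) :
  (forall i, i \in r -> spanned s (F i)) -> spanned s (\sum_(i <- r) F i).
Proof.
move=> sF; rewrite big_seq; elim/big_ind : _ => //; last exact: spannedD.
by exists (fun=> 0); rewrite big1 // => i _; rewrite scale0r.
Qed.

(** Decomposing the unit along [e] gives a matrix description: [star v * x * w] is a scalar multiple
    of [e], so the products [v * star w] span the algebra. *)
Lemma minimal_finite_dim e1 e : M e1 -> is_proj e1 ->
  (forall x, M x -> e1 * x = x /\ x * e1 = x) ->
  minimal_proj e -> exists s : seq A, forall x, M x -> spanned s x.
Proof.
move=> Me1 e1P e1M e_min; have [Me eP e0 _] := e_min.
have [s [sP _ s_sum _ _]] := decomposition Me eP e0 Me1 e1P.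
exists [seq v * star w | v <- s, w <- s] => x Mx.
have [x1 x2] := e1M x Mx.
rewrite -x1 -x2 -s_sum mulr_suml; apply: spanned_sum => v vs.
rewrite !mulr_sumr; apply: spanned_sum => w ws.
have [Mv _ _ ve] := sP v vs; have [Mw _ _ we] := sP w ws.
have Msv := sa_star MA Mv.
have [|||c cE] := @minimal_scalar e (star v * x * w) e_min.
- by apply: (saM MA) => //; exact: (saM MA).
- by rewrite !mulrA -{1}eP.2 -starM ve.
- by rewrite -mulrA we.
have -> : v * star v * (x * (w * star w)) = v * (star v * x * w) * star w.
  by rewrite !mulrA.
rewrite cE mulZr ve mulZl; apply: spannedZ.
by apply/allpairsP; exists (v, w).
Qed.

(** Without minimal projections, every nonzero projection has a proper nonzero subprojection, and
    either that one or its complement has at most half the trace. *)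
Lemma small_projection e1 e (eps : R) : M e1 -> is_proj e1 ->
  (forall x, M x -> e1 * x = x /\ x * e1 = x) ->
  (~ exists s : seq A, forall x, M x -> spanned s x) ->
  M e -> is_proj e -> e != 0 -> 0 < eps ->
  exists q, [/\ M q, is_proj q, q != 0, e * q = q & tr q < eps].
Proof.
move=> Me1 e1P e1M Minf Me eP e0 eps0.
have half q : M q -> is_proj q -> q != 0 -> exists r,
    [/\ M r, is_proj r, r != 0, q * r = r & tr r <= tr q / 2].
  move=> Mq qP q0.
  have [r [Mr rP qr r0 rq]] : exists r,
      [/\ M r, is_proj r, q * r = r, r != 0 & r != q].
    apply: contrapT => h; apply: Minf; apply: (minimal_finite_dim Me1 e1P e1M (e := q)).
    split=> // r Mr rP qr; have [->|r0] := eqVneq r 0; first by left.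
    by right; apply/eqP/negPn/negP => rq; apply: h; exists r.
  have [tr_le|tr_gt] := leP (tr r) (tr q / 2); first by exists r.
  exists (q - r); split.
  - exact: saB.
  - exact: proj_sub.
  - by rewrite subr_eq0 eq_sym.
  - by rewrite mulrBr qP.1 qr.
  - by rewrite (trB MA Mtr) //; lra.
have iter_half n : exists q,
    [/\ M q, is_proj q, q != 0, e * q = q & tr q * 2 ^+ n <= tr e].
  elim: n => [|n [q [Mq qP q0 eq qn]]].
    by exists e; rewrite mulr1 eP.1.
  have [r [Mr rP r0 qr rn]] := half q Mq qP q0.
  exists r; split=> //; first by rewrite -qr mulrA eq.
  apply: le_trans qn; rewrite exprS mulrA ler_wpM2r ?exprn_ge0 //; lra.
pose n := (Num.truncn (tr e / eps)).+1.
have [q [Mq qP q0 eq qn]] := iter_half n.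
exists q; split=> //.
have n2 : n%:R < 2 ^+ n :> R by rewrite -natrX ltr_nat ltn_expl.
have := truncnS_gt (tr e / eps); rewrite -/n ltr_pdivrMr // => h.
have trq := tr_proj_gt0 Mtr Mq qP q0.
rewrite -(@ltr_pM2r _ (2 ^+ n)) ?exprn_gt0 //; nra.
Qed.

End Decomposition.

(** * Costs and generators *)

Section Bridge.
Variables (R : realType) (H : hilbertType R).
Local Notation C := R[i].
Local Notation A := (adjop H).
Implicit Types (x y p q : A) (f g : H -> H) (M : set (H -> H)).

Definition ops M : set A := [set x : A | M x].

Lemma adjop_inj x y : x = y :> (H -> H) -> x = y.
Proof. by move=> xy; apply: adjop_eq => u; rewrite xy. Qed.

Lemma adjop_bounded_operator x : bounded_operators x.
Proof.
by split; [move=> c u v; rewrite opD opZ|exact: op_continuous].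
Qed.

Lemma bounded_operator_bound f : bounded_operators f ->
  exists2 c : C, 0 <= c & forall u, `|f u| <= c * `|u|.
Proof.
move=> [fl fc]; pose F := HB.pack_for {linear H -> H} f
  (GRing.isLinear.Build _ _ _ _ f fl).
have /linear_boundedP : bounded_near F (nbhs 0).
  by apply/linear_bounded_continuous.
move=> /pinfty_ex_gt0 [c c0 cP]; exists c; [exact: ltW|exact: cP].
Qed.

Lemma vna_lift M f : von_neumann_algebra M -> M f ->
  exists2 x : A, ops M x & f = x.
Proof.
move=> MV Mf; have [g Mg fg] := vna_adjoint MV Mf.
by exists (Adjop fg (bounded_operator_bound (vna_bounded MV Mf))).
Qed.

(** The map from [g] to [a \o g \o b] is continuous for pointwise convergence. This is how strong
    closure is checked for algebras defined through entries, both for the pieces [v] and for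
    matrices. *)
Lemma closure_ptws_comp (K : hilbertType R) (a : H -> K) (b : K -> H)
    (S : set (H -> H)) (T : set (K -> K)) f :
  continuous a -> (forall g, S g -> T (a \o g \o b)) ->
  closure (S : set {ptws H -> H}) f ->
  closure (T : set {ptws K -> K}) (a \o f \o b).
Proof.
move=> ac ST; rewrite !closureEcvg => -[G PG [Gf GS]].
pose phi (g : H -> H) : K -> K := a \o g \o b.
exists (phi @ G); first exact: fmap_proper_filter.
split; last first.
  have GS' : G S by apply: GS.
  move=> E TE; have: G (phi @^-1` E) by apply: filterS GS' => g /ST; exact: TE.
  by [].
apply/(@pointwise_cvgP K K _ (phi f)) => t.
have /(_ (b t)) h : forall u, (fun g : H -> H => g u) @ G --> f u.
  exact/(@pointwise_cvgP H H G f _).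
exact: (cvg_comp _ _ h (ac _)).
Qed.

Lemma closure_ptws_lim M (x : nat -> H -> H) f : (forall n, M (x n)) ->
  (forall u, x n u @[n --> \oo] --> f u) -> closure (M : set {ptws H -> H}) f.
Proof.
move=> Mx xf; rewrite closureEcvg; exists (x @ \oo); first exact: fmap_proper_filter.
split; last by move=> E ME; exists 0%N => // n _; apply: ME.
by apply/(@pointwise_cvgP H H _ f).
Qed.

Lemma vna_star_algebra M : von_neumann_algebra M -> star_algebra (ops M).
Proof.
move=> MV; split.
- have E : adjop_fun (0 : A) = 0 by apply/funext => u; rewrite zeroE.
  by change (M (adjop_fun (0 : A))); rewrite E; exact: vna0.
- by move=> c x y Mx My; exact: vna_linear.
- by move=> x y Mx My; exact: vna_comp.
- move=> x Mx; have [g Mg xg] := vna_adjoint MV Mx.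
  have E : adjop_fun (star x) = g.
    apply/funext => v; apply: hdot_inj => u.
    by rewrite hdot_starl hdotC xg -hdotC.
  by change (M (adjop_fun (star x))); rewrite E.
- move=> x y Mx xy; apply: (vna_closed MV); split.
    exact: adjop_bounded_operator.
  exact: closure_ptws_lim Mx xy.
Qed.

Lemma adjoint_starE x f : adjoint x f -> f = star x.
Proof.
move=> xf; apply/funext => v; apply: hdot_inj => u.
by rewrite hdotC -xf -hdotC hdot_starl.
Qed.

Lemma self_adjointE x : self_adjoint x <-> star x = x.
Proof.
split=> [/adjoint_starE sx|sx]; first exact: adjop_inj.
by move=> u v; rewrite hdot_star sx.
Qed.

Lemma is_projectionE p : is_projection p <-> is_proj p.
Proof.
split=> [[pp /self_adjointE sp]|[pp sp]].
  by split=> //; exact: adjop_inj.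
by split; [exact: (congr1 (@adjop_fun R H) pp)|apply/self_adjointE].
Qed.

Lemma is_unitE M p : von_neumann_algebra M ->
  is_unit M p <-> ops M p /\ forall x, ops M x -> p * x = x /\ x * p = x.
Proof.
move=> MV; split=> -[Mp pM]; split=> // x Mx.
  by have [px xp] := pM x Mx; split; exact: adjop_inj.
have [y My ->] := vna_lift MV Mx; have [py yp] := pM y My.
by split; [rewrite -[RHS](congr1 (@adjop_fun R H) py)|
  rewrite -[RHS](congr1 (@adjop_fun R H) yp)].
Qed.

Lemma neq0E x : ((x : H -> H) != 0) = (x != 0).
Proof.
apply/idP/idP; apply: contra_neq => x0.
  by apply/funext => u; rewrite x0 zeroE.
by apply: adjop_eq => u; rewrite x0 zeroE.
Qed.

(** Constructions are carried out on lists; repetitions disappear here, which [undup] records on the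
    side of sums. *)
Definition fset_of (s : seq A) : {fset H -> H} :=
  seq_fset tt [seq (x : H -> H) | x <- s].

Lemma big_fset_of (T : Type) (idx : T) (op : Monoid.com_law idx) (s : seq A)
    (P : pred (H -> H)) (F : (H -> H) -> T) :
  \big[op/idx]_(f <- fset_of s | P f) F f =
  \big[op/idx]_(x <- undup s | P x) F x.
Proof.
have h : perm_eq (fset_of s) [seq (x : H -> H) | x <- undup s].
  by rewrite -(undup_map_inj adjop_inj); exact: seq_fset_perm.
by rewrite (perm_big _ h) big_map.
Qed.

Lemma in_fset_of (s : seq A) f :
  f \in fset_of s <-> exists2 x, x \in s & f = x.
Proof. by rewrite seq_fsetE; split=> [/mapP|h]; [|apply/mapP]. Qed.

Lemma fset_lift M (P : {fset H -> H}) : von_neumann_algebra M ->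
  (forall f, f \in P -> M f) ->
  exists s : seq A, [/\ uniq s, P = fset_of s & forall x, x \in s -> ops M x].
Proof.
move=> MV PM; have : forall f, exists x : A, f \in P -> ops M x /\ f = x.
  move=> f; have [fP|] := boolP (f \in P); last by exists 0.
  by have [x Mx fx] := vna_lift MV (PM _ fP); exists x.
move=> /choice [lift liftP].
exists [seq lift f | f <- P]; split.
- rewrite map_inj_in_uniq ?fset_uniq // => f g fP gP fg.
  by rewrite (liftP _ fP).2 (liftP _ gP).2 fg.
- apply/fsetP => f; apply/idP/idP => [fP|/in_fset_of[_ /mapP[g gP ->] ->]].
    apply/in_fset_of; exists (lift f); first exact: map_f.
    by have [] := liftP _ fP.
  by have [_ <-] := liftP _ gP.
- by move=> _ /mapP[f fP ->]; have [] := liftP _ fP.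
Qed.

End Bridge.

(** * Cost of an operator relative to a partition *)

Section Cost.
Variables (R : realType) (H : hilbertType R).
Local Notation A := (adjop H).
Implicit Types (x y a b p q : A) (s : seq A).

Definition cost (tr : A -> R) x s :=
  \sum_(p <- s) \sum_(q <- s | p * x * q != 0) tr p * tr q.

Lemma support_sizeE (tau : (H -> H) -> R[i]) x s :
  support_size tau x (fset_of s) = cost (fun p => complex.Re (tau p)) x (undup s).
Proof.
rewrite /support_size big_fset_of; apply: eq_bigr => p _.
by rewrite big_fset_of; apply: eq_bigl => q; rewrite -neq0E.
Qed.

Variables (tr : A -> R) (s : seq A).
Hypothesis tr_ge0 : forall p, p \in s -> 0 <= tr p.

Lemma cost_add x y : cost tr (x + y) s <= cost tr x s + cost tr y s.
Proof.
rewrite /cost -big_split /= big_seq [leRHS]big_seq; apply: ler_sum => p ps.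
rewrite [leLHS]big_mkcond [X in _ <= X + _]big_mkcond [X in _ <= _ + X]big_mkcond /=.
rewrite -big_split /= big_seq [leRHS]big_seq; apply: ler_sum => q qs.
have t0 : 0 <= tr p * tr q by rewrite mulr_ge0 ?tr_ge0.
rewrite mulrDr mulrDl.
have [->|_] := eqVneq (p * x * q) 0; have [->|_] := eqVneq (p * y * q) 0 => /=.
- by rewrite !addr0 eqxx.
- by rewrite add0r; case: ifP; rewrite ?add0r.
- by rewrite addr0; case: ifP; rewrite ?addr0.
- by case: ifP => _; rewrite ?lerDl ?addr_ge0.
Qed.

Lemma cost_corner x a b : uniq s -> a \in s -> b \in s ->
  (forall p, p \in s -> p != a -> p * a = 0) ->
  (forall q, q \in s -> q != b -> b * q = 0) ->
  a * x * b = x -> cost tr x s <= tr a * tr b.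
Proof.
move=> s_uniq sa sb pa bq axb; rewrite /cost (bigD1_seq a) //=.
rewrite [X in _ + X]big1_seq ?addr0; last first.
  move=> p /andP[pna ps]; rewrite big1 // => q; rewrite -axb !mulrA pa //.
  by rewrite !mul0r eqxx.
rewrite big_mkcond (bigD1_seq b) //= big1_seq ?addr0; last first.
  move=> q /andP[qnb qs]; rewrite -axb -mulrA -[_ * b * q]mulrA bq //.
  by rewrite !mulr0 eqxx.
by case: ifP => // _; rewrite mulr_ge0 ?tr_ge0.
Qed.

Lemma cost0 : cost tr 0 s = 0.
Proof.
by rewrite /cost big1 // => p _; rewrite big1 // => q; rewrite mulr0 mul0r eqxx.
Qed.

End Cost.

Section Sums.
Variables (R : realType) (H : hilbertType R).
Local Notation A := (adjop H).

Lemma sum_undup_le (T : eqType) (s : seq T) (F : T -> R) :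
  (forall x, x \in s -> 0 <= F x) ->
  \sum_(x <- undup s) F x <= \sum_(x <- s) F x.
Proof.
elim: s => [|x s IHs] F0 /=; first by [].
have Fs : forall y, y \in s -> 0 <= F y by move=> y ys; rewrite F0 // inE ys orbT.
rewrite [leRHS]big_cons; case: ifP => _; last by rewrite big_cons lerD2l IHs.
by rewrite (le_trans (IHs Fs)) // lerDr F0 // inE eqxx.
Qed.

(** A projection repeated in an orthogonal list is zero, since [p = p * p = 0]. *)
Lemma sum_undup_orthogonal (s : seq A) :
  (forall p, p \in s -> p * p = p) -> pairwise (fun p q => p * q == 0) s ->
  \sum_(p <- undup s) p = \sum_(p <- s) p.
Proof.
elim: s => [//|p s IHs] pp /= /andP[/allP ps s_orth].
have IH := IHs (fun q qs => pp q (mem_behead (s := p :: s) qs)) s_orth.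
rewrite [RHS]big_cons; case: ifP => [sp|_]; last by rewrite big_cons IH.
by have /eqP := ps p sp; rewrite (pp p) ?inE ?eqxx // => ->; rewrite add0r IH.
Qed.

Lemma pairwise_neq (T : eqType) (r : rel T) (s : seq T) : symmetric r ->
  pairwise r s -> forall x y, x \in s -> y \in s -> x != y -> r x y.
Proof.
move=> r_sym; elim: s => [//|z s IHs] /= /andP[/allP zs s_r] x y.
rewrite !inE => /predU1P[->|xs] /predU1P[->|ys] xy.
- by rewrite eqxx in xy.
- exact: zs.
- by rewrite r_sym; exact: zs.
- exact: IHs.
Qed.

End Sums.

(** * Transport between Hilbert spaces, and linked corners *)

Section Sandwich.
Variables (R : realType) (H K : hilbertType R).
Variables (a : H -> K) (a' : K -> H) (b : K -> H) (b' : H -> K).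
Hypotheses (aa' : forall u v, hdot (a u) v = hdot u (a' v))
  (bb' : forall u v, hdot (b u) v = hdot u (b' v))
  (a_bound : exists2 c : R[i], 0 <= c & forall u, `|a u| <= c * `|u|)
  (b_bound : exists2 c : R[i], 0 <= c & forall u, `|b u| <= c * `|u|).

Fact sandwich_adjoint (x : adjop H) :
  adjoint (a \o x \o b) (b' \o star x \o a').
Proof. by move=> u v; rewrite /= aa' hdot_star bb'. Qed.

Fact sandwich_bound (x : adjop H) :
  exists2 c : R[i], 0 <= c & forall u, `|(a \o x \o b) u| <= c * `|u|.
Proof.
have [c c0 ac] := a_bound; have [d d0 bd] := b_bound.
have [k k0 xk] := adjop_bound x.
exists (c * (k * d)) => [|u /=]; first by rewrite !mulr_ge0.
rewrite -!mulrA (le_trans (ac _)) // ler_wpM2l // (le_trans (xk _)) //.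
by rewrite ler_wpM2l.
Qed.

(** Common form of the transport between corners, of matrix entries and of elementary matrices. *)
Definition sandwich (x : adjop H) : adjop K :=
  Adjop (@sandwich_adjoint x) (sandwich_bound x).

End Sandwich.

Section Transport.
Variables (R : realType) (H K : hilbertType R) (w : H -> K) (w' : K -> H).
Hypotheses (ww' : forall u v, hdot (w u) v = hdot u (w' v))
  (wb : exists2 c : R[i], 0 <= c & forall u, `|w u| <= c * `|u|).

Lemma adjoint_bound :
  exists2 c : R[i], 0 <= c & forall u, `|w' u| <= c * `|u|.
Proof.
by have [c c0 wc] := wb; exists c => //; exact: (adjoint_bounded ww' c0 wc).
Qed.

Definition transport : adjop H -> adjop K :=
  sandwich ww' (adjoint_sym ww') wb adjoint_bound.

Lemma transport_star x : star (transport x) = transport (star x).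
Proof. exact: adjop_eq. Qed.

Lemma transportD x y : transport (x + y) = transport x + transport y.
Proof.
by apply: adjop_eq => u; rewrite addE /= (adjoint_additive ww').
Qed.

Lemma transportZ c x : transport (c *: x) = c *: transport x.
Proof.
by apply: adjop_eq => u; rewrite scaleE /= (adjoint_scalable ww').
Qed.

Lemma transport0 : transport 0 = 0.
Proof. by rewrite -[X in transport X](scale0r (0 : adjop H)) transportZ scale0r. Qed.

End Transport.

Section FiniteFactor.
Variables (R : realType).
Implicit Types H K : hilbertType R.

(* Diffuseness is left out: it enters only through the existence of links of
   arbitrarily small trace. *)
Record finite_factor H (M : set (H -> H)) (tau : (H -> H) -> R[i]) : Prop :=
  FiniteFactor {
  ff_vna : von_neumann_algebra M;
  ff_tracial : tracial (ops M) (fun x => complex.Re (tau x));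
  ff_prime : prime_algebra (ops M);
  ff_unit : exists2 e : adjop H, is_unit M e & complex.Re (tau e) = 1
}.

(* [w] is a partial isometry that identifies a corner of [M] with a corner of
   [N], and [c] is the ratio of the two traces. *)
Record link H K (M : set (H -> H)) (tau : (H -> H) -> R[i])
    (N : set (K -> K)) (sigma : (K -> K) -> R[i]) (c : R)
    (w : H -> K) (w' : K -> H) : Prop := Link {
  link_adjoint : forall u v, hdot (w u) v = hdot u (w' v);
  link_bound : exists2 c : R[i], 0 <= c & forall u, `|w u| <= c * `|u|;
  link_isometry : forall u, w (w' (w u)) = w u;
  link_transport : forall x : adjop H, M x -> N (w \o x \o w');
  link_transport' : forall y : adjop K, N y -> M (w' \o y \o w);
  link_initial : M (w' \o w);
  link_final : N (w \o w');
  link_trace : complex.Re (sigma (w \o w')) = c * complex.Re (tau (w' \o w))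
}.

Lemma link_sym H K M tau N sigma c (w : H -> K) w' : 0 < c ->
  link M tau N sigma c w w' -> link N sigma M tau c^-1 w' w.
Proof.
move=> c0 L; have ww' := link_adjoint L; have w'wE := adjoint_sym ww'.
split=> //.
- exact: (adjoint_bound ww' (link_bound L)).
- move=> v; apply: hdot_inj => u.
  by rewrite w'wE ww' w'wE (link_isometry L) w'wE.
- exact: link_transport' L.
- exact: link_transport L.
- exact: link_final L.
- exact: link_initial L.
- by rewrite (link_trace L) mulKf // gt_eqF.
Qed.

End FiniteFactor.

Section Gram.
Variables (R : realType) (H K : hilbertType R) (w : H -> K) (w' : K -> H).
Hypotheses (ww' : forall u v, hdot (w u) v = hdot u (w' v))
  (wb : exists2 c : R[i], 0 <= c & forall u, `|w u| <= c * `|u|).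

Fact gram_adjoint : adjoint (w' \o w) (w' \o w).
Proof. by move=> u v; rewrite /= (adjoint_sym ww') ww'. Qed.

Fact gram_bound :
  exists2 c : R[i], 0 <= c & forall u, `|(w' \o w) u| <= c * `|u|.
Proof.
have [c c0 wc] := wb; have w'c := adjoint_bounded ww' c0 wc.
exists (c * c) => [|u /=]; first exact: mulr_ge0.
by rewrite -mulrA (le_trans (w'c _)) // ler_wpM2l.
Qed.

Definition gram : adjop H := Adjop gram_adjoint gram_bound.

End Gram.

Section Generation.
Variables (R : realType) (H K : hilbertType R).
Variables (M : set (H -> H)) (tau : (H -> H) -> R[i]).
Variables (N : set (K -> K)) (sigma : (K -> K) -> R[i]) (c : R).
Variables (w : H -> K) (w' : K -> H).
Hypotheses (MV : von_neumann_algebra M) (NV : von_neumann_algebra N).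
Hypothesis L : link M tau N sigma c w w'.

Let ww' := link_adjoint L.
Let wb := link_bound L.
Let w'w : forall u v, hdot (w' u) v = hdot u (w v) := adjoint_sym ww'.
Let w'b := adjoint_bound ww' wb.

Let Phi := transport ww' wb.
Let Psi := transport w'w w'b.
Let e := gram ww' wb.
Let f := gram w'w w'b.

Lemma link_isometry' u : w' (w (w' u)) = w' u.
Proof.
apply: hdot_inj => v; by rewrite w'w ww' w'w (link_isometry L) w'w.
Qed.

Lemma PhiM x y : Phi x * Phi y = Phi (x * e * y).
Proof. exact: adjop_eq. Qed.

Lemma PhiPsi y : Phi (Psi y) = f * y * f.
Proof. exact: adjop_eq. Qed.

Lemma PsiPhi x : Psi (Phi x) = e * x * e.
Proof. exact: adjop_eq. Qed.

Lemma Phi_l x : f * Phi x = Phi x.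
Proof. by apply: adjop_eq => u /=; rewrite (link_isometry L). Qed.

Lemma Phi_r x : Phi x * f = Phi x.
Proof. by apply: adjop_eq => u /=; rewrite link_isometry'. Qed.

Lemma gram_e_proj : is_proj e.
Proof.
split; apply: adjop_eq => u /=; last by [].
by rewrite (link_isometry L).
Qed.

Lemma gram_f_proj : is_proj f.
Proof.
split; apply: adjop_eq => u /=; last by [].
by rewrite (link_isometry L).
Qed.

Lemma Phi_in x : ops M x -> ops N (Phi x).
Proof. exact: link_transport L x. Qed.

Lemma Psi_in y : ops N y -> ops M (Psi y).
Proof. exact: link_transport' L y. Qed.

Lemma gram_e_in : ops M e. Proof. exact: link_initial L. Qed.
Lemma gram_f_in : ops N f. Proof. exact: link_final L. Qed.

(** Any number whose square is not real would serve: the passage from two entries to their two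
    combinations has determinant [a * a - a' * a'], here [4 * 'i]. Taking the conjugate as second
    coefficient makes the combinations self-adjoint when [x] is. *)
Definition gen_coef : R[i] := 1 + 'i.
Local Notation a := gen_coef.
Local Notation a' := (Num.conj gen_coef).

Lemma gen_coefE : a * a - a' * a' = 4 * 'i.
Proof. by rewrite /gen_coef rmorphD rmorph1 /= conjCi; move: 'i => j; ring. Qed.

(* Exchanging [v] and [v'] gives a second combination of the same two entries,
   from which both can be recovered. *)
Definition entry_gen x v v' : adjop K :=
  a *: Phi (star v * x * v') + a' *: Phi (star v' * x * v).

Lemma entry_gen_recover x v v' :
  Phi (star v * x * v') = (4 * 'i)^-1 *:
    (a *: entry_gen x v v' - a' *: entry_gen x v' v).
Proof.
rewrite /entry_gen; set y := Phi _; set z := Phi _; rewrite -gen_coefE.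
have k0 : a * a - a' * a' != 0.
  by rewrite gen_coefE mulf_neq0 ?neq0Ci ?pnatr_eq0.
move: (a) (a') k0 => p q k0.
have -> : p *: (p *: y + q *: z) - q *: (p *: z + q *: y) =
    (p * p - q * q) *: y.
  by rewrite !scalerDr !scalerA [q * p]mulrC addrKA -scalerBl.
by rewrite scalerA mulVf // scale1r.
Qed.

Lemma entry_gen_star x v v' : star x = x ->
  star (entry_gen x v v') = entry_gen x v v'.
Proof.
move=> sx; rewrite /entry_gen starD !starZ conjCK /Phi !transport_star.
by rewrite !starM !starK sx !mulrA addrC.
Qed.

(** The elements of [M] all of whose entries along [V] are transported into [B] form a von Neumann
    algebra containing [X], hence everything. A piece with initial projection exactly [e] then
    brings the whole corner of [f] into [B], and [U] spreads this corner over [N]. *)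
Lemma generation (X : seq (adjop H)) (V : seq (adjop H)) (U : seq (adjop K))
    (e1 : adjop H) (f1 : adjop K) (B : set (K -> K)) :
  (forall x, x \in X -> ops M x) -> generated_vna [set` fset_of X] = M ->
  (forall x, ops M x -> e1 * x = x /\ x * e1 = x) ->
  (forall v, v \in V -> ops M v /\ v * e = v) ->
  \sum_(v <- V) v * star v = e1 ->
  (exists2 v, v \in V & star v * v = e) ->
  (forall y, ops N y -> f1 * y = y /\ y * f1 = y) ->
  (forall u, u \in U -> [/\ ops N u, u * f = u & f * u = 0]) ->
  \sum_(u <- U) u * star u + f = f1 ->
  von_neumann_algebra B ->
  (forall x v v', x \in X -> v \in V -> v' \in V -> ops B (entry_gen x v v')) ->
  (forall u, u \in U -> ops B (u + star u)) ->
  N `<=` B.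
Proof.
move=> XM genX e1P VM V1 [v0 v0V v0e] f1P UN U1 BV XB UB.
have MA := vna_star_algebra MV; have NA := vna_star_algebra NV.
have BA := vna_star_algebra BV.
pose M' := [set g : H -> H | M g /\ forall x : adjop H, g = x ->
  forall v v', v \in V -> v' \in V -> ops B (Phi (star v * x * v'))].
have M'V : von_neumann_algebra M'.
  split.
  - by move=> g [Mg _]; exact: vna_bounded MV _ Mg.
  - split; first exact: vna0 MV.
    move=> x x0 v v' _ _; have -> : x = 0.
      by apply: adjop_eq => u; rewrite -x0 zeroE.
    by rewrite mulr0 mul0r /Phi transport0; exact: sa0.
  - move=> a g h [Mg Bg] [Mh Bh]; split; first exact: vna_linear.
    have [x Mx xE] := vna_lift MV Mg; have [y My yE] := vna_lift MV Mh.
    move=> z zE v v' Vv Vv'; have -> : z = a *: x + y.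
      by apply: adjop_eq => u; rewrite -zE xE yE.
    rewrite mulrDr mulrDl mulZr mulZl /Phi transportD transportZ.
    by apply: (sa_lin BA); [exact: Bg|exact: Bh].
  - move=> g h [Mg Bg] [Mh Bh]; split; first exact: vna_comp.
    have [x Mx xE] := vna_lift MV Mg; have [y My yE] := vna_lift MV Mh.
    (* Inserting the unit as a sum over [V] turns an entry of a product into a sum of products of
       entries; [e] appears between them because [u * e = u]. *)
    move=> z zE v v' Vv Vv'; have -> : z = x * (\sum_(u <- V) u * star u) * y.
      rewrite V1 -mulrA (e1P _ My).1.
      by apply: adjop_eq => u; rewrite -zE xE yE.
    rewrite mulr_sumr mulr_suml mulr_sumr mulr_suml.
    rewrite /Phi (big_morph _ (transportD ww' wb) (transport0 ww' wb)) -/Phi big_seq.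
    apply: sa_sum => // u uV.
    have [_ ue] := VM u uV; rewrite -/Phi.
    have -> : star v * (x * (u * star u) * y) * v' =
        (star v * x * u) * e * (star u * y * v').
      by rewrite -!mulrA [u * (e * _)]mulrA ue.
    by rewrite -PhiM; apply: (saM BA); [exact: Bg|exact: Bh].
  - move=> g [Mg Bg]; have [x Mx xE] := vna_lift MV Mg.
    exists (star x); last by rewrite xE; exact: adjopP.
    split; first exact: (sa_star MA).
    move=> y yE v v' Vv Vv'; have -> : y = star x.
      by apply: adjop_eq => u; rewrite -yE.
    have -> : star v * star x * v' = star (star v' * x * v).
      by rewrite !starM starK mulrA.
    rewrite /Phi -transport_star -/Phi; apply: (sa_star BA); exact: Bg.
  - move=> g [gb gM']; have Mg : M g.
      apply: (vna_closed MV); split=> //.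
      by apply: closure_subset gM' => h [].
    split=> // x gx v v' Vv Vv'; apply: (vna_closed BV); split.
      exact: adjop_bounded_operator.
    rewrite gx in gM'.
    have -> : (Phi (star v * x * v') : K -> K) =
        (w \o star v) \o x \o (v' \o w') by [].
    apply: closure_ptws_comp gM'.
      move=> u; apply: continuous_comp; first exact: op_continuous.
      have [d d0 wd] := wb; exact: (adjoint_continuous ww' d0 wd).
    move=> h [Mh Bh]; have [y My yE] := vna_lift MV Mh.
    by rewrite yE; exact: (Bh y yE v v' Vv Vv').
have MM' : M `<=` M'.
  rewrite -genX; apply: smallest_sub => // g /= /in_fset_of[x xX ->].
  split; first by apply: XM.
  move=> y /adjop_inj <- v v' Vv Vv'; rewrite entry_gen_recover.
  by apply: saZ => //; apply: saB => //; apply: saZ => //; exact: XB.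
(* An element of the corner of [f] is the entry at [(v0, v0)] of [v0 * Psi y * star v0]. *)
have corner_in y : ops N y -> f * y * f = y -> ops B y.
  move=> Ny fyf; pose x := v0 * Psi y * star v0.
  have [Mv0 _] := VM v0 v0V.
  have Mx : ops M x.
    apply: (saM MA); last exact: (sa_star MA).
    by apply: (saM MA) => //; exact: Psi_in.
  have [_ /(_ x erefl v0 v0 v0V v0V)] := MM' _ Mx.
  have -> : star v0 * x * v0 = e * Psi y * e by rewrite -v0e /x !mulrA.
  have -> : Phi (e * Psi y * e) = y; last by [].
  by rewrite -PsiPhi PhiPsi PhiPsi fyf fyf.
have fB : ops B f by apply: corner_in gram_f_in _; rewrite !gram_f_proj.1.
have BU u : u \in U -> ops B u.
  move=> uU; have [Nu uf fu] := UN u uU.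
  (* The self-adjoint generator determines [u], because the initial space of [u] is in the range of
     [f] and its final space is orthogonal to it. *)
  have -> : u = (u + star u) * f.
    have suf : star u * f = 0 by rewrite -gram_f_proj.2 -starM fu star0.
    by rewrite mulrDl uf suf addr0.
  by apply: (saM BA) => //; exact: UB.
move=> g Ng; have [y Ny ->] := vna_lift NV Ng.
have Bf_sum (F : adjop K -> adjop K) : (forall u, u \in f :: U -> ops B (F u)) ->
    ops B (\sum_(u <- f :: U) F u).
  by move=> FB; rewrite big_seq; apply: (sa_sum BA).
have f1E : f1 = \sum_(u <- f :: U) u * star u.
  by rewrite big_cons gram_f_proj.2 gram_f_proj.1 addrC.
have fUN u : u \in f :: U -> [/\ ops N u, ops B u & u * f = u].
  rewrite inE => /predU1P[->|uU].
    by split=> //; [exact: gram_f_in|exact: gram_f_proj.1].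
  by have [Nu uf _] := UN u uU; split=> //; exact: BU.
change (ops B y); rewrite -(f1P y Ny).1 -(f1P y Ny).2 f1E mulr_suml.
apply: (Bf_sum) => u /fUN[Nu Bu uf]; rewrite !mulr_sumr.
apply: (Bf_sum) => v /fUN[Nv Bv vf].
(* The middle factor [star u * y * v] lies in the corner of [f], already known to be in [B]. *)
have -> : u * star u * (y * (v * star v)) = u * (star u * y * v) * star v.
  by rewrite !mulrA.
apply: (saM BA); last exact: (sa_star BA).
apply: (saM BA) => //; apply: corner_in.
  apply: (saM NA) => //; apply: (saM NA) => //; exact: (sa_star NA).
have fu : f * star u = star u by rewrite -{1}gram_f_proj.2 -starM uf.
by rewrite !mulrA fu -!mulrA vf.
Qed.

End Generation.

Section AdjopSum.
Variables (R : realType) (H : hilbertType R).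
Local Notation A := (adjop H).

Lemma sum_adjop_fun (I : Type) (s : seq I) (F : I -> A) :
  \sum_(i <- s) (F i : H -> H) = (\sum_(i <- s) F i : A).
Proof.
symmetry; apply: (big_morph (@adjop_fun R H)) => //.
by apply/funext => u; rewrite zeroE.
Qed.

Lemma cost_ge0 (tr : A -> R) x s : (forall p, p \in s -> 0 <= tr p) ->
  0 <= cost tr x s.
Proof.
move=> tr0; rewrite /cost big_seq; apply: sumr_ge0 => p ps.
rewrite big_seq_cond; apply: sumr_ge0 => q /andP[qs _].
by rewrite mulr_ge0 ?tr0.
Qed.

Lemma sum_const_seq (T : eqType) (s : seq T) (a : R) :
  \sum_(x <- s) a = (size s)%:R * a.
Proof. by rewrite big_const_seq count_predT iter_addr_0 mulr_natl. Qed.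

End AdjopSum.

(** * The comparison inequality *)

Section Upper.
Variables (R : realType) (H K : hilbertType R).
Variables (M : set (H -> H)) (tau : (H -> H) -> R[i]).
Variables (N : set (K -> K)) (sigma : (K -> K) -> R[i]) (c : R).
Variables (w : H -> K) (w' : K -> H).
Hypotheses (FM : finite_factor M tau) (FN : finite_factor N sigma).
Hypotheses (c0 : 0 < c) (L : link M tau N sigma c w w').

Let MV := ff_vna FM.
Let NV := ff_vna FN.
Let MA := vna_star_algebra MV.
Let NA := vna_star_algebra NV.
Let Mtr := ff_tracial FM.
Let Ntr := ff_tracial FN.
Let tr (x : adjop H) := complex.Re (tau x).
Let trN (y : adjop K) := complex.Re (sigma y).
Let e := gram (link_adjoint L) (link_bound L).
Let f := gram (adjoint_sym (link_adjoint L))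
  (adjoint_bound (link_adjoint L) (link_bound L)).

(** For [p * x * q] nonzero, the pieces of [p] and [q] give at most
    [(tr p / tr e + 1) * (tr q / tr e + 1)] generators of cost at most [(c * tr e) ^ 2] each;
    otherwise these generators vanish. The last term bounds the cost of [U]. The projection [p0]
    guarantees a full piece, which [generation] requires. *)
Lemma G_sa_upper_link (X P : seq (adjop H)) :
  (forall x, x \in X -> ops M x /\ star x = x) ->
  generated_vna [set` fset_of X] = M ->
  (forall p, p \in P -> ops M p /\ is_proj p) ->
  is_unit M (\sum_(p <- P) p : adjop H) ->
  0 < tr e -> (exists2 p, p \in P & tr e < tr p) ->
  (G_sa N sigma <= (c ^+ 2 * (\sum_(x <- X) \sum_(p <- P)
      \sum_(q <- P | (p * x * q)%R != 0%R) (tr p + tr e) * (tr q + tr e))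
    + 2 * (c * tr e))%:E)%E.
Proof.
move=> XM genX PM P1 tre_gt0 [p0 p0P p0e].
have eP : is_proj e := gram_e_proj L; have fP : is_proj f := gram_f_proj L.
have Me : ops M e := gram_e_in L; have Nf : ops N f := gram_f_in L.
have e0 : e != 0.
  by apply: contraTneq tre_gt0 => ->; rewrite /tr (tr0 MA Mtr) ltxx.
have trf : trN f = c * tr e := link_trace L.
have f0 : f != 0.
  have : 0 < trN f by rewrite trf mulr_gt0.
  by apply: contraTneq => ->; rewrite /trN (tr0 NA Ntr) ltxx.
have [f1' f1U f1tr] := ff_unit FN.
have [Nf1 f1P] := (is_unitE _ NV).1 f1U.
have f1proj : is_proj f1' := unit_proj NA Nf1 f1P.
have Nf' : ops N (f1' - f) by exact: saB.
have f'P : is_proj (f1' - f) by apply: proj_sub => //; case: (f1P f Nf).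
have ff' : f * (f1' - f) = 0.
  by rewrite mulrBr fP.1 (f1P f Nf).2 subrr.
have [U [UN U_orth U_sum _ _]] :=
  decomposition NA Ntr (ff_prime FN) Nf fP f0 Nf' f'P.
have Uf u : u \in U -> f * u = 0.
  by move=> /UN[_ _ fu _]; rewrite -fu mulrA ff' mul0r.
have sUf u : u \in U -> star u * f = 0.
  by move=> /Uf fu; rewrite -fP.2 -starM fu star0.
pose Dspec p (s : seq (adjop H)) :=
  [/\ forall v, v \in s -> [/\ ops M v, partial_isometry v, p * v = v & v * e = v],
      \sum_(v <- s) v * star v = p,
      (size s)%:R * tr e <= tr p + tr e &
      tr e < tr p -> exists2 v, v \in s & star v * v = e].
have /choice[D DP] : forall p, exists s, p \in P -> Dspec p s.
  move=> p; have [pP|] := boolP (p \in P); last by exists [::].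
  have [Mp pproj] := PM p pP.
  have [s [s1 _ s2 s3 s4]] := decomposition MA Mtr (ff_prime FM) Me eP e0 Mp pproj.
  by exists s.
pose V := flatten [seq D p | p <- P].
have VE v : v \in V -> exists2 p, p \in P & v \in D p.
  by move=> /flatten_mapP[p pP vD]; exists p.
have big_V (F : adjop H -> R) :
    \sum_(v <- V) F v = \sum_(p <- P) \sum_(v <- D p) F v.
  by rewrite big_flatten big_map.
(* This list may repeat the zero projection, so sums over it are taken after [undup]. *)
pose QL := f :: [seq u * star u | u <- U].
pose XL := [seq entry_gen L x vv.1 vv.2 |
    x <- X, vv <- [seq (v, v') | v <- V, v' <- V]]
   ++ [seq u + star u | u <- U].
have QN q : q \in undup QL -> ops N q /\ is_proj q.
  rewrite mem_undup inE => /predU1P[->//|/mapP[u /UN[Nu uP _ _] ->]].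
  by split; [apply: (saM NA) => //; exact: (sa_star NA)|exact: pi_final].
have QL_orth : pairwise (fun p q => (p * q == 0) && (q * p == 0)) QL.
  rewrite /QL pairwise_cons; apply/andP; split.
    apply/allP => _ /mapP[u uU ->].
    by rewrite mulrA Uf // mul0r -mulrA sUf // mulr0 eqxx.
  rewrite pairwise_map; apply: sub_pairwise U_orth => u v /eqP uv /=.
  have vu : star v * u = 0 by rewrite -[u]starK -starM uv star0.
  by rewrite -!mulrA ![star _ * (_ * _)]mulrA uv vu !(mul0r, mulr0) eqxx.
have Q_orth p q : p \in undup QL -> q \in undup QL -> p != q -> p * q = 0.
  rewrite !mem_undup => pQ qQ pq.
  have r_sym : symmetric (fun p q : adjop K => (p * q == 0) && (q * p == 0)).
    by move=> x y; rewrite andbC.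
  by have /andP[/eqP] := pairwise_neq r_sym QL_orth pQ qQ pq.
have Q_unit : \sum_(q <- undup QL) q = f1'.
  rewrite sum_undup_orthogonal; last 2 first.
  - by move=> q; rewrite -mem_undup => /QN[_ []].
  - by apply: sub_pairwise QL_orth => p q /andP[].
  by rewrite big_cons big_map U_sum addrC subrK.
have QP : partition_of_unity N (fset_of QL).
  split.
  - move=> q /in_fset_of[y]; rewrite -mem_undup => /QN[Ny yP] ->.
    by split=> //; apply/is_projectionE.
  - move=> p q /in_fset_of[y yQ ->] /in_fset_of[z zQ ->] yz.
    have yz0 : y * z = 0.
      by apply: Q_orth; rewrite ?mem_undup //; apply: contraNneq yz => ->.
    have yz0E : y \o z = adjop_fun (0 : adjop K) := congr1 (@adjop_fun R K) yz0.
    by rewrite yz0E; apply/funext => u; rewrite zeroE.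
  - by rewrite big_fset_of sum_adjop_fun Q_unit.
have trN_ge0 q : q \in undup QL -> 0 <= trN q.
  by move=> /QN[Nq qP]; exact: (tr_proj_ge0 Ntr).
have fQ : f \in undup QL by rewrite mem_undup inE eqxx.
have XN x vv : x \in X -> vv \in [seq (v, v') | v <- V, v' <- V] ->
    ops N (entry_gen L x vv.1 vv.2) /\
    star (entry_gen L x vv.1 vv.2) = entry_gen L x vv.1 vv.2.
  move=> /XM[Mx sx] /allpairsP[[v v'] /= [/VE[p pP vD] /VE[q qP vD'] ->]] /=.
  have [/(_ v vD)[Mv _ _ _] _ _ _] := DP p pP.
  have [/(_ v' vD')[Mv' _ _ _] _ _ _] := DP q qP.
  have Ms := sa_star MA; split; last exact: entry_gen_star.
  apply: saD => //; apply: saZ => //; apply: Phi_in;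
    by apply: (saM MA) => //; apply: (saM MA) => //; exact: Ms.
have UsN u : u \in U -> ops N (u + star u) /\ star (u + star u) = u + star u.
  move=> /UN[Nu _ _ _]; split; last by rewrite starD starK addrC.
  by apply: saD => //; exact: (sa_star NA).
have XLN y : y \in XL -> ops N y /\ star y = y.
  rewrite mem_cat => /orP[/allpairsP[[x vv] /= [xX vvV ->]]|/mapP[u uU ->]].
    exact: XN.
  exact: UsN.
have genN : generated_vna [set` fset_of XL] = N.
  apply/seteqP; split.
    apply: smallest_sub => // g /= /in_fset_of[y /XLN[Ny _] ->]; exact: Ny.
  move=> g Ng B [BV XLB].
  have BX y : y \in XL -> ops B y.
    by move=> yXL; apply: XLB; apply/in_fset_of; exists y.
  suff NB : N `<=` B by exact: NB.
  apply: (generation (L := L) MV NV (X := X) (V := V) (U := U)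
    (e1 := \sum_(p <- P) p) (f1 := f1') (B := B)) => //.
  - by move=> x /XM[].
  - by have [_] := (is_unitE _ MV).1 P1.
  - move=> v /VE[p pP vD]; have [/(_ v vD)[Mv _ _ ve] _ _ _] := DP p pP.
    by split.
  - rewrite big_flatten big_map big_seq [RHS]big_seq; apply: eq_bigr => p pP.
    by have [_ ->] := DP p pP.
  - have [_ _ _ /(_ p0e)[v vD vE]] := DP p0 p0P; exists v => //.
    by apply/flatten_mapP; exists p0.
  - move=> u uU; have [Nu _ _ uf] := UN u uU; split=> //; exact: Uf.
  - by rewrite U_sum subrK.
  - move=> x v v' xX vV v'V; apply: BX; rewrite mem_cat; apply/orP; left.
    apply/allpairsP; exists (x, (v, v')); split=> //=.
    by apply/allpairsP; exists (v, v').
  - by move=> u uU; apply: BX; rewrite mem_cat; apply/orP; right; apply/mapP; exists u.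
apply: (@le_trans _ _ (finset_invariant N sigma (fset_of XL))).
  apply: ereal_inf_lbound; exists (fset_of XL) => //; split=> // g.
  by move=> /in_fset_of[y /XLN[Ny sy] ->]; split=> //; apply/self_adjointE.
apply: (@le_trans _ _
    (\sum_(x <- fset_of XL) support_size sigma x (fset_of QL))%:E).
  by apply: ereal_inf_lbound; exists (fset_of QL).
rewrite lee_fin; apply: (@le_trans _ _ (\sum_(y <- XL) cost trN y (undup QL))).
  rewrite big_fset_of; under eq_bigr do rewrite support_sizeE.
  by apply: sum_undup_le => y _; exact: cost_ge0.
rewrite big_cat big_allpairs_dep big_map /=; apply: lerD; last first.
  apply: (@le_trans _ _ (\sum_(u <- U) 2 * trN f * trN (u * star u))).
    rewrite big_seq [leRHS]big_seq; apply: ler_sum => u uU.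
    have [Nu uP _ uf] := UN u uU.
    have uQ : u * star u \in undup QL.
      rewrite mem_undup inE; apply/orP; right; apply/mapP; by exists u.
    have a_orth a : a \in undup QL ->
        (forall p, p \in undup QL -> p != a -> p * a = 0) /\
        (forall p, p \in undup QL -> p != a -> a * p = 0).
      move=> aQ; split=> p pQ pa; first exact: Q_orth.
      by apply: Q_orth; rewrite // eq_sym.
    have [fl fr] := a_orth _ fQ; have [ul ur] := a_orth _ uQ.
    (* [u] occupies the block from [f] to [u * star u], and [star u] the opposite one. *)
    apply: le_trans (cost_add trN_ge0 _ _) _.
    have -> : 2 * trN f * trN (u * star u) =
        trN (u * star u) * trN f + trN f * trN (u * star u) by ring.
    apply: lerD; apply: cost_corner => //; rewrite ?undup_uniq //.
      by rewrite -mulrA uf uP.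
    have fsu : f * star u = star u by rewrite -{1}fP.2 -starM uf.
    by rewrite fsu mulrA starMM_pi.
  rewrite -mulr_sumr -trf.
  have -> : \sum_(u <- U) trN (u * star u) = trN (f1' - f).
    rewrite -U_sum [in RHS]big_seq /trN (tr_sum NA Ntr) ?big_seq // => u uU.
    have [Nu _ _ _] := UN u uU; apply: (saM NA) => //; exact: (sa_star NA).
  have -> : trN (f1' - f) = 1 - trN f by rewrite /trN (trB NA Ntr) // f1tr.
  by have := sqr_ge0 (trN f); rewrite expr2; lra.
rewrite mulr_sumr big_seq [leRHS]big_seq; apply: ler_sum => x xX.
have [Mx sx] := XM x xX.
pose F v v' := cost trN (entry_gen L x v v') (undup QL).
have -> : \sum_(vv <- [seq (v, v') | v <- V, v' <- V])
    cost trN (entry_gen L x vv.1 vv.2) (undup QL) =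
    \sum_(p <- P) \sum_(q <- P) \sum_(v <- D p) \sum_(v' <- D q) F v v'.
  rewrite big_allpairs_dep big_V; apply: eq_bigr => p _.
  rewrite [RHS]exchange_big /=; apply: eq_bigr => v _; exact: big_V.
rewrite mulr_sumr big_seq [leRHS]big_seq; apply: ler_sum => p pP.
rewrite [X in c ^+ 2 * X]big_mkcond mulr_sumr big_seq [leRHS]big_seq.
apply: ler_sum => q qP.
have [pD _ p_size _] := DP p pP; have [qD _ q_size _] := DP q qP.
have FE v v' : v \in D p -> v' \in D q ->
    F v v' <= (if p * x * q != 0 then trN f * trN f else 0).
  move=> vD v'D; have [Mv _ pv _] := pD v vD; have [Mv' _ qv _] := qD v' v'D.
  (* Both entries in the generator vanish together: since [x] is self-adjoint, they are adjoint to
     each other. *)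
  have [pxq|_] := eqVneq (p * x * q) 0.
    have vxv : star v * x * v' = 0.
      rewrite -pv -qv starM ((PM p pP).2.2).
      have -> : star v * p * x * (q * v') = star v * (p * x * q) * v'.
        by rewrite !mulrA.
      by rewrite pxq mulr0 mul0r.
    have vxv' : star v' * x * v = 0.
      have -> : star v' * x * v = star (star v * x * v').
        by rewrite !starM starK sx mulrA.
      by rewrite vxv star0.
    by rewrite /F /entry_gen vxv vxv' !transport0 !scaler0 addr0 cost0.
  apply: cost_corner => //; first exact: undup_uniq.
  - by move=> r rQ rf; exact: Q_orth.
  - by move=> r rQ rf; apply: Q_orth; rewrite // eq_sym.
  - by rewrite /entry_gen mulrDr mulrDl !mulZr !mulZl !Phi_l !Phi_r.
apply: (@le_trans _ _ (\sum_(v <- D p) \sum_(v' <- D q)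
    (if p * x * q != 0 then trN f * trN f else 0))).
  rewrite big_seq [leRHS]big_seq; apply: ler_sum => v vD.
  by rewrite big_seq [leRHS]big_seq; apply: ler_sum => v' v'D; exact: FE.
rewrite !sum_const_seq; case: ifP => _; last by rewrite !mulr0.
rewrite trf; set m := (size (D p))%:R in p_size *.
set k := (size (D q))%:R in q_size *.
have m0 : 0 <= m by rewrite ler0n.
have k0 : 0 <= k by rewrite ler0n.
have -> : m * (k * (c * tr e * (c * tr e))) = c ^+ 2 * ((m * tr e) * (k * tr e)).
  by ring.
by rewrite ler_wpM2l ?sqr_ge0 // ler_pM // mulr_ge0 // ltW.
Qed.

End Upper.

Section Comparison.
Variables (R : realType) (H K : hilbertType R).
Variables (M : set (H -> H)) (tau : (H -> H) -> R[i]).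
Variables (N : set (K -> K)) (sigma : (K -> K) -> R[i]) (c : R).
Hypotheses (FM : finite_factor M tau) (FN : finite_factor N sigma).
Hypotheses (c0 : 0 < c) (small_link : forall eps : R, 0 < eps ->
  exists w w', [/\ link M tau N sigma c w w',
    0 < complex.Re (tau (w' \o w)) & complex.Re (tau (w' \o w)) < eps]).

Let MV := ff_vna FM.
Let MA := vna_star_algebra MV.
Let Mtr := ff_tracial FM.
Let tr (x : adjop H) := complex.Re (tau x).

(** The constant 3 bounds [tr p + tr q + d], by which [d] is multiplied in the expansion of each
    product. *)
Lemma cost_perturbation (X P : seq (adjop H)) (d : R) : 0 <= d <= 1 ->
  (forall p, p \in P -> 0 <= tr p <= 1) ->
  \sum_(x <- X) \sum_(p <- P) \sum_(q <- P | p * x * q != 0)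
    (tr p + d) * (tr q + d) <=
  \sum_(x <- X) cost tr x P + (size X)%:R * ((size P)%:R * ((size P)%:R * (3 * d))).
Proof.
move=> /andP[d0 d1] P01; rewrite -!sum_const_seq -big_split /=.
apply: ler_sum => x _; rewrite /cost -big_split /=.
rewrite big_seq [leRHS]big_seq; apply: ler_sum => p pP.
rewrite [leLHS]big_mkcond [X in _ <= X + _]big_mkcond -big_split /=.
rewrite big_seq [leRHS]big_seq; apply: ler_sum => q qP.
have /andP[p0 p1] := P01 p pP; have /andP[q0 q1] := P01 q qP.
by case: ifP => _; nra.
Qed.

Lemma G_sa_upper (X P : {fset H -> H}) (eta : R) : 0 < eta ->
  (forall x, x \in X -> M x /\ self_adjoint x) ->
  generated_vna [set` X] = M -> partition_of_unity M P ->
  (G_sa N sigma <= (c ^+ 2 * (\sum_(x <- X) support_size tau x P) + eta)%:E)%E.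
Proof.
move=> eta0 XM genX [PM P_orth P_unit].
have [Xs [Xs_uniq XE XsM]] := fset_lift MV (fun x xX => (XM x xX).1).
have [Ps [Ps_uniq PE PsM]] := fset_lift MV (fun p pP => (PM p pP).1).
have PsP p : p \in Ps -> ops M p /\ is_proj p.
  move=> pPs; split; first exact: PsM.
  by apply/is_projectionE; apply: (PM p _).2; rewrite PE; apply/in_fset_of; exists p.
have XsP x : x \in Xs -> ops M x /\ star x = x.
  move=> xXs; split; first exact: XsM.
  by apply/self_adjointE; apply: (XM x _).2; rewrite XE; apply/in_fset_of; exists x.
have Ps_unit : is_unit M (\sum_(p <- Ps) p : adjop H).
  by move: P_unit; rewrite PE big_fset_of undup_id // sum_adjop_fun.
have [e1 e1U e1tr] := ff_unit FM.
have [Me1 e1P] := (is_unitE _ MV).1 e1U.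
have [MPs PsU] := (is_unitE _ MV).1 Ps_unit.
have e1E : \sum_(p <- Ps) p = e1.
  by rewrite -[LHS](e1P _ MPs).1 (PsU _ Me1).2.
have e1proj : is_proj e1 := unit_proj MA Me1 e1P.
have tr01 p : p \in Ps -> 0 <= tr p <= 1.
  move=> /PsP[Mp pP]; rewrite /tr (tr_proj_ge0 Mtr) //= -e1tr.
  by rewrite (tr_proj_le MA Mtr) // (e1P p Mp).1.
have [p0 p0Ps p0_gt0] : exists2 p, p \in Ps & 0 < tr p.
  apply: contrapT => h; have : tr e1 <= 0.
    rewrite -e1E big_seq /tr (tr_sum MA Mtr) => [|p /PsP[]//].
    apply: sumr_le0 => p pPs.
    by rewrite leNgt; apply/negP => tp; apply: h; exists p.
  by rewrite /tr e1tr ler10.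
set T := \sum_(x <- X) _.
have TE : T = \sum_(x <- Xs) cost tr x Ps.
  rewrite /T XE big_fset_of undup_id //; apply: eq_bigr => x _.
  by rewrite PE support_sizeE undup_id.
pose n : R := (size Xs)%:R * ((size Ps)%:R * ((size Ps)%:R * 3)).
have n0 : 0 <= n by rewrite !mulr_ge0.
pose k := c ^+ 2 * n + 2 * c.
have k0 : 0 < k.
  apply: ltr_wpDl; first exact: mulr_ge0 (sqr_ge0 c) n0.
  by rewrite mulr_gt0.
(* The three bounds serve [cost_perturbation], the existence of a full piece inside [p0], and a
   total error [d * k] below [eta]. *)
pose eps := Num.min 1 (Num.min (tr p0) (eta / k)).
have eps0 : 0 < eps by rewrite !lt_min ltr01 p0_gt0 divr_gt0.
have [w [w' [L d0]]] := small_link eps0.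
rewrite !lt_min => /andP[d1 /andP[dp0 dk]].
have := @G_sa_upper_link _ _ _ M tau N sigma c w w' FM FN c0 L Xs Ps XsP.
rewrite -XE => /(_ genX PsP Ps_unit d0 (ex_intro2 _ _ p0 p0Ps dp0)) h.
apply: le_trans h _; rewrite lee_fin TE.
set d := complex.Re (tau (gram (link_adjoint L) (link_bound L))).
have dE : d = complex.Re (tau (w' \o w)) by [].
have d01 : 0 <= d <= 1 by rewrite dE !ltW.
have := cost_perturbation Xs d01 tr01; rewrite -/tr.
set S := \sum_(x <- Xs) _; set S' := \sum_(x <- Xs) _ => hS.
have {}dk : d * k < eta by rewrite -ltr_pdivlMr.
have c2 : 0 <= c ^+ 2 by exact: sqr_ge0.
have := ler_wpM2l c2 hS.
have -> : (size Xs)%:R * ((size Ps)%:R * ((size Ps)%:R * (3 * d))) = n * d :> R.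
  by rewrite /n !mulrA.
rewrite mulrDr => h2; apply: le_trans (lerD h2 (lexx _)) _.
rewrite -addrA lerD2l.
by have -> : c ^+ 2 * (n * d) + 2 * (c * d) = d * k; [rewrite /k; ring|exact: ltW].
Qed.

Lemma G_sa_le : (G_sa N sigma <= (c ^+ 2)%:E * G_sa M tau)%E.
Proof.
have c2 : 0 < c ^+ 2 by rewrite exprn_gt0.
rewrite -lee_pdivrMl //; apply: le_ereal_inf_tmp => _ [X [XM genX] <-].
apply: le_ereal_inf_tmp => _ [P PP <-].
rewrite lee_pdivrMl // -EFinM; apply/lee_addgt0Pr => eta eta0.
rewrite -EFinD; exact: G_sa_upper.
Qed.

End Comparison.

(** * Amplifications *)

Section FromII1.
Variables (R : realType) (H : hilbertType R).
Variables (M : set (H -> H)) (tau : (H -> H) -> R[i]).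
Hypothesis M_II1 : II1_factor M tau.

Let M_factor : Defs.factor M. Proof. by case: M_II1. Qed.
Let MV : von_neumann_algebra M := factor_vna M_factor.
Let MA := vna_star_algebra MV.
Let M_trace : faithful_normal_trace M tau. Proof. by case: M_II1. Qed.

(** Positivity makes the trace of [star x * x] real, so faithfulness survives taking real parts. *)
Lemma II1_tracial : tracial (ops M) (fun x => complex.Re (tau x)).
Proof.
have pos x : ops M x -> 0 <= tau (star x \o x).
  move=> Mx; apply: (tau_ge0 M_trace) => //; last exact: adjopP.
  exact: (sa_star MA).
split.
- move=> x y Mx My; have := tau_linear M_trace 1 Mx My.
  by rewrite scale1r mul1r -raddfD => <-.
- by move=> x /pos; rewrite lecE => /andP[].
- move=> x Mx tx0; apply: adjop_inj.
  have -> : adjop_fun (0 : adjop H) = 0 by apply/funext => u; rewrite zeroE.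
  apply: (tau_faithful M_trace Mx (sa_star MA Mx)); first exact: adjopP.
  by rewrite -[LHS]RRe_real ?ger0_real ?pos // [complex.Re _]tx0.
- by move=> x y Mx My; congr complex.Re; exact: (tau_trace M_trace).
Qed.

Lemma II1_unit : exists2 e : adjop H, is_unit M e & complex.Re (tau e) = 1.
Proof.
have [g [gU _]] := factor_unit M_factor.
have [e Me eE] := vna_lift MV gU.1; rewrite eE in gU.
by exists e => //; rewrite (tau1 M_trace gU).
Qed.

Lemma II1_prime : prime_algebra (ops M).
Proof.
have [g [gU gZ]] := factor_unit M_factor.
have [e Me eE] := vna_lift MV gU.1; rewrite eE in gU gZ.
have [_ eP] := (is_unitE _ MV).1 gU.
apply: (factor_prime MA II1_tracial Me eP) => z Mz zZ.
have [|c cE] := gZ z Mz.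
  move=> h Mh; have [x Mx ->] := vna_lift MV Mh.
  exact: (congr1 (@adjop_fun R H) (zZ x Mx)).
by exists c; apply: adjop_inj.
Qed.

Lemma II1_finite_factor : finite_factor M tau.
Proof. by split; [|exact: II1_tracial|exact: II1_prime|exact: II1_unit]. Qed.

Lemma II1_small_projection (q : adjop H) (eps : R) : 0 < eps ->
  ops M q -> is_proj q -> q != 0 ->
  exists r, [/\ ops M r, is_proj r, r != 0, q * r = r &
    complex.Re (tau r) < eps].
Proof.
move=> eps0 Mq qP q0; have [e eU _] := II1_unit.
have [Me eM] := (is_unitE _ MV).1 eU.
have eP : is_proj e := unit_proj MA Me eM.
apply: (small_projection MA II1_tracial II1_prime Me eP eM) => // -[s sM].
have [_ Minf _] := M_II1; apply: Minf; exists [seq adjop_fun x | x <- s] => f Mf.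
have [x Mx ->] := vna_lift MV Mf; have [c ->] := sM x Mx.
exists c; rewrite -sum_adjop_fun size_map; apply: eq_bigr => i _.
by rewrite (nth_map 0).
Qed.

End FromII1.

(** * Matrix algebras over a von Neumann algebra *)

Section Matrix.
Variables (R : realType) (H : hilbertType R) (n : nat).
Local Notation C := R[i].
Local Notation K := (hsum H n).
Implicit Types (x y : adjop K) (m : adjop H) (i j k : 'I_n) (u v : K).

Definition hsum_proj i (u : K) : H := u i.

Lemma hsum_injE i (v : H) j : hsum_inj i v j = if j == i then v else 0.
Proof. by rewrite ffunE. Qed.

Lemma hsum_inj_adjoint i (v : H) u : hdot (hsum_inj i v) u = hdot v (hsum_proj i u).
Proof.
have -> : hdot (hsum_inj i v) u = \sum_j hdot (hsum_inj i v j) (u j) by [].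
rewrite (bigD1 i) //= hsum_injE eqxx big1 ?addr0 // => j ji.
by rewrite hsum_injE (negPf ji) hdot0l.
Qed.

Lemma hsum_proj_adjoint i u (v : H) : hdot (hsum_proj i u) v = hdot u (hsum_inj i v).
Proof. by rewrite hdotC -hsum_inj_adjoint -hdotC. Qed.

Lemma hsum_inj_bound i :
  exists2 c : C, 0 <= c & forall v : H, `|hsum_inj i v| <= c * `|v|.
Proof.
exists 1 => // v; rewrite mul1r -ler_sqr ?nnegrE // -!hdotxx.
by rewrite hsum_inj_adjoint /hsum_proj hsum_injE eqxx.
Qed.

Lemma hsum_proj_bound i :
  exists2 c : C, 0 <= c & forall u, `|hsum_proj i u| <= c * `|u|.
Proof.
have [c c0 ic] := hsum_inj_bound i; exists c => //.
exact: (adjoint_bounded (hsum_inj_adjoint i) c0 ic).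
Qed.

Definition entry_op x i j : adjop H :=
  sandwich (hsum_proj_adjoint i) (hsum_inj_adjoint j)
    (hsum_proj_bound i) (hsum_inj_bound j) x.

(** The elementary tensor of [m] with the matrix unit at [(i, j)]. *)
Definition unit_op m i j : adjop K :=
  sandwich (hsum_inj_adjoint i) (hsum_proj_adjoint j)
    (hsum_inj_bound i) (hsum_proj_bound j) m.

Lemma hsum_sumE (I : Type) (r : seq I) (F : I -> K) i :
  (\sum_(a <- r) F a) i = \sum_(a <- r) F a i.
Proof.
by apply: (big_morph (fun u : K => u i)) => [u v|]; rewrite ffunE.
Qed.

Lemma hsum_decomp u : u = \sum_j hsum_inj j (u j).
Proof.
apply/ffunP => i; rewrite hsum_sumE (bigD1 i) //= hsum_injE eqxx.
by rewrite big1 ?addr0 // => j ji; rewrite hsum_injE eq_sym (negPf ji).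
Qed.

Lemma entry_opE x u i : x u i = \sum_j entry_op x i j (u j).
Proof.
rewrite {1}(hsum_decomp u) (big_morph x (opD x) (op0 x)) hsum_sumE.
by [].
Qed.

Lemma entry_op_inj x y :
  (forall i j, entry_op x i j = entry_op y i j) -> x = y.
Proof.
move=> xy; apply: adjop_eq => u; apply/ffunP => i.
by rewrite !entry_opE; apply: eq_bigr => j _; rewrite xy.
Qed.

Lemma entry_opD x y i j : entry_op (x + y) i j = entry_op x i j + entry_op y i j.
Proof. by apply: adjop_eq => v; rewrite /= /hsum_proj ffunE. Qed.

Lemma entry_opZ c x i j : entry_op (c *: x) i j = c *: entry_op x i j.
Proof. by apply: adjop_eq => v; rewrite /= /hsum_proj ffunE. Qed.

Lemma entry_op0 i j : entry_op 0 i j = 0.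
Proof. by rewrite -[X in entry_op X](scale0r (0 : adjop K)) entry_opZ scale0r. Qed.

Lemma entry_op_star x i j : entry_op (star x) i j = star (entry_op x j i).
Proof. exact: adjop_eq. Qed.

Lemma entry_opM x y i j :
  entry_op (x * y) i j = \sum_k entry_op x i k * entry_op y k j.
Proof.
apply: adjop_eq => v.
have -> : entry_op (x * y) i j v = x (y (hsum_inj j v)) i by [].
by rewrite entry_opE -sum_adjop_fun fct_sumE.
Qed.

Lemma entry_unit_op m i j k l :
  entry_op (unit_op m i j) k l = if (k == i) && (l == j) then m else 0.
Proof.
apply: adjop_eq => v; rewrite /= /hsum_proj !hsum_injE (eq_sym j l).
by case: (k == i); case: (l == j); rewrite ?op0 ?zeroE.
Qed.

Lemma mul_unit_op x m i j k l :
  entry_op (x * unit_op m i j) k l = if l == j then entry_op x k i * m else 0.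
Proof.
rewrite entry_opM (bigD1 i) //= entry_unit_op eqxx /= big1 ?addr0.
  by case: ifP; rewrite ?mulr0.
by move=> a ai; rewrite entry_unit_op (negPf ai) mulr0.
Qed.

Lemma unit_op_mul x m i j k l :
  entry_op (unit_op m i j * x) k l = if k == i then m * entry_op x j l else 0.
Proof.
rewrite entry_opM (bigD1 j) //= entry_unit_op eqxx andbT big1 ?addr0.
  by case: ifP; rewrite ?mul0r.
by move=> a aj; rewrite entry_unit_op (negPf aj) andbF mul0r.
Qed.

Section MatrixVna.
Variables (M : set (H -> H)) (MV : von_neumann_algebra M).

(** The adjoint is written down directly as the transposed matrix of the adjoints of the entries,
    which exist because the entries lie in [M]. *)
Lemma matrix_lift T : matrix_vna M T ->
  exists2 x : adjop K, T = x & forall i j, ops M (entry_op x i j).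
Proof.
move=> [Tb TM]; have /choice[F FE] : forall ij : 'I_n * 'I_n,
    exists m : adjop H, ops M m /\ entry T ij.1 ij.2 = m.
  by move=> [i j]; have [m Mm mE] := vna_lift MV (TM i j); exists m.
have TE u i : T u i = \sum_j F (i, j) (u j).
  pose G := HB.pack_for {linear K -> K} T (GRing.isLinear.Build _ _ _ _ T Tb.1).
  rewrite {1}(hsum_decomp u); have -> : T = G by [].
  rewrite linear_sum hsum_sumE; apply: eq_bigr => j _.
  by have [_ <-] := FE (i, j).
pose S (u : K) : K := [ffun j => \sum_i star (F (i, j)) (u i)].
have TS : adjoint T S.
  move=> u v; have -> : hdot (T u) v = \sum_i hdot (T u i) (v i) by [].
  have -> : hdot u (S v) = \sum_i hdot (u i) (S v i) by [].
  transitivity (\sum_i \sum_j hdot (F (i, j) (u j)) (v i)).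
    apply: eq_bigr => i _; rewrite TE.
    exact: (big_morph (fun w => hdot w (v i)) (fun a b => hdotDl a b (v i)) (hdot0l _)).
  rewrite exchange_big; apply: eq_bigr => j _; rewrite ffunE.
  rewrite (big_morph (hdot (u j)) (fun a b => hdotDr a b (u j)) (hdot0r _)).
  by apply: eq_bigr => i _; rewrite hdot_star.
by exists (Adjop TS (bounded_operator_bound Tb)).
Qed.

Lemma ops_matrix_vna x :
  ops (matrix_vna M) x <-> forall i j, ops M (entry_op x i j).
Proof.
split=> [[_ xM]|xM]; first exact: xM.
by split; [exact: adjop_bounded_operator|exact: xM].
Qed.

Lemma matrix_vna_von_neumann : von_neumann_algebra (@matrix_vna R H n M).
Proof.
have MA := vna_star_algebra MV.
split.
- by move=> T [].
- have -> : (0 : K -> K) = (0 : adjop K) by apply/funext => u; rewrite zeroE.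
  by apply/ops_matrix_vna => i j; rewrite entry_op0; exact: sa0.
- move=> c S T /matrix_lift[x -> xM] /matrix_lift[y -> yM].
  have : ops (matrix_vna M) (c *: x + y).
    apply/ops_matrix_vna => i j; rewrite entry_opD entry_opZ.
    exact: (sa_lin MA).
  by [].
- move=> S T /matrix_lift[x -> xM] /matrix_lift[y -> yM].
  have : ops (matrix_vna M) (x * y).
    apply/ops_matrix_vna => i j; rewrite entry_opM.
    by apply: (sa_sum MA) => k _; exact: (saM MA).
  by [].
- move=> T /matrix_lift[x -> xM]; exists (star x); last exact: adjopP.
  apply/ops_matrix_vna => i j; rewrite entry_op_star; exact: (sa_star MA).
- move=> T [[Tl Tc] cT]; split=> // i j; apply: (vna_closed MV); split.
    split.
      move=> c u v; rewrite /entry.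
      have -> : hsum_inj j (c *: u + v) = c *: hsum_inj j u + hsum_inj j v.
        rewrite (adjoint_additive (hsum_inj_adjoint j)).
        by rewrite (adjoint_scalable (hsum_inj_adjoint j)).
      by rewrite Tl !ffunE.
    have -> : entry T i j = hsum_proj i \o (T \o hsum_inj j) by [].
    have [c c0 ic] := hsum_inj_bound j; have [d d0 pd] := hsum_proj_bound i.
    move=> v; apply: continuous_comp; last first.
      exact: (adjoint_continuous (hsum_proj_adjoint i) d0 pd).
    apply: continuous_comp; last exact: Tc.
    exact: (adjoint_continuous (hsum_inj_adjoint j) c0 ic).
  have -> : entry T i j = (hsum_proj i \o T) \o hsum_inj j by [].
  apply: closure_ptws_comp cT.
    have [d d0 pd] := hsum_proj_bound i.
    exact: (adjoint_continuous (hsum_proj_adjoint i) d0 pd).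
  by move=> S [_ SM]; exact: SM.
Qed.

End MatrixVna.

End Matrix.

(** * Corners of von Neumann algebras *)

Section Corner.
Variables (R : realType) (H : hilbertType R) (M : set (H -> H)).
Variables (MV : von_neumann_algebra M) (p : adjop H).
Hypotheses (Mp : ops M p) (pP : is_proj p).

Lemma cornerE f : corner M p f <-> M f /\ p \o f \o p = f.
Proof.
split=> [[g Mg <-]|[Mf pf]]; last by exists f.
have [x Mx ->] := vna_lift MV Mg; split.
  by apply: (vna_comp MV) => //; exact: (vna_comp MV).
have pxp : p * (p * x * p) * p = p * x * p.
  by rewrite !mulrA pP.1 -!mulrA pP.1.
exact: (congr1 (@adjop_fun R H) pxp).
Qed.

Lemma ops_corner x : ops (corner M p) x <-> ops M x /\ p * x * p = x.
Proof.
split=> [/cornerE[Mx px]|[Mx px]]; first by split=> //; exact: adjop_inj.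
by apply/cornerE; split=> //; exact: (congr1 (@adjop_fun R H) px).
Qed.

Lemma corner_mul x : p * x * p = x -> p * x = x /\ x * p = x.
Proof.
move=> <-; split; first by rewrite !mulrA pP.1.
by rewrite -mulrA pP.1.
Qed.

Lemma corner_von_neumann : von_neumann_algebra (corner M p).
Proof.
have MA := vna_star_algebra MV.
have lift f : corner M p f -> exists2 x : adjop H, ops (corner M p) x & f = x.
  move=> /[dup] cf /cornerE[Mf _]; have [x Mx fx] := vna_lift MV Mf.
  by exists x => //; rewrite fx in cf.
split.
- by move=> f /cornerE[Mf _]; exact: (vna_bounded MV).
- exists 0; first exact: (vna0 MV).
  by apply/funext => u; exact: op0.
- move=> c f g /lift[x /ops_corner[Mx px] ->] /lift[y /ops_corner[My py] ->].
  have : ops (corner M p) (c *: x + y); last by [].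
  apply/ops_corner; split; first exact: (sa_lin MA).
  by rewrite mulrDr mulrDl mulZr mulZl px py.
- move=> f g /lift[x /ops_corner[Mx px] ->] /lift[y /ops_corner[My py] ->].
  have : ops (corner M p) (x * y); last by [].
  apply/ops_corner; split; first exact: (saM MA).
  have [px' _] := corner_mul px; have [_ yp'] := corner_mul py.
  by rewrite mulrA px' -mulrA yp'.
- move=> f /lift[x /ops_corner[Mx px] ->]; exists (star x); last exact: adjopP.
  apply/ops_corner; split; first exact: (sa_star MA).
  by rewrite -[in RHS]px !starM pP.2 mulrA.
- move=> f [fb cf]; apply/cornerE; split.
    apply: (vna_closed MV); split=> //; apply: closure_subset cf => g.
    by move=> /cornerE[].
  move: cf; rewrite closureEcvg => -[G PG [Gf GS]].
  have GS' : G (corner M p) by apply: GS.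
  have Gu u : (fun g : H -> H => g u) @ G --> f u.
    by move: u; exact/(@pointwise_cvgP H H G f _).
  apply/funext => u; apply: (@cvg_unique _ (@norm_hausdorff _ _)
    ((fun g : H -> H => g u) @ G)); last exact: Gu.
  have pGu : (fun g : H -> H => p (g (p u))) @ G --> p (f (p u)).
    exact: (cvg_comp _ _ (Gu _) (@op_continuous _ _ p _)).
  apply: cvg_trans pGu; apply: near_eq_cvg.
  by apply: filterS GS' => g /cornerE[_ pg]; rewrite -[in RHS]pg.
Qed.

End Corner.

(** * The amplification as a finite factor linked to [M] *)

Section Amplification.
Variables (R : realType) (H : hilbertType R).
Variables (M : set (H -> H)) (tau : (H -> H) -> R[i]).
Hypothesis M_II1 : II1_factor M tau.
Variables (t : R) (n : nat) (p : adjop (hsum H n)).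
Hypotheses (t_gt0 : 0 < t) (t_lt_n : t < n%:R).
Hypotheses (Mp : ops (matrix_vna M) p) (pP : is_proj p).
Hypothesis tau_p : matrix_trace tau p = (t / n%:R)%:C.

Local Notation K := (hsum H n).
Local Notation N := (corner (matrix_vna M) p).
Local Notation sigma := (corner_trace (matrix_trace tau) p).
Let FM := II1_finite_factor M_II1.
Let MV := ff_vna FM.
Let MA := vna_star_algebra MV.
Let Mtr := ff_tracial FM.
Let tr (m : adjop H) := complex.Re (tau m).
Let AV : von_neumann_algebra (@matrix_vna R H n M) := matrix_vna_von_neumann n MV.
Let AA := vna_star_algebra AV.
Let trA (x : adjop K) := \sum_i tr (entry_op x i i).

(** The size [n] cancels: the normalised matrix trace carries [1 / n], and dividing by the trace
    [t / n] of [p] leaves [1 / t]. *)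
Lemma corner_traceE (x : adjop K) : complex.Re (sigma x) = t^-1 * trA x.
Proof.
have n0 : n%:R != 0 :> R by rewrite gt_eqF // (lt_trans t_gt0).
have -> : sigma x = (t^-1)%:C * \sum_i tau (entry x i i).
  rewrite /corner_trace tau_p /matrix_trace.
  have -> : (n%:R^-1 : R[i]) = (n%:R^-1)%:C by rewrite fmorphV rmorph_nat.
  rewrite mulrAC -fmorphV -rmorphM /=; congr (_%:C * _).
  by rewrite invf_div mulrA mulVf // mul1r.
have ReM (a : R) (z : R[i]) : complex.Re (a%:C * z) = a * complex.Re z.
  by case: z => z1 z2 /=; rewrite mul0r subr0.
by rewrite ReM raddf_sum.
Qed.

Lemma corner_trace1 : sigma p = 1.
Proof.
have n0 : n%:R != 0 :> R by rewrite gt_eqF // (lt_trans t_gt0).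
rewrite /corner_trace divff // tau_p (inj_eq (@complexI R) _ 0).
by rewrite mulf_neq0 ?invr_eq0 // gt_eqF.
Qed.

Lemma matrix_tracial : tracial (ops (matrix_vna M)) trA.
Proof.
have Ms := sa_star MA; have inM x := (ops_matrix_vna M x).1.
have trA_starM x : ops (matrix_vna M) x ->
    trA (star x * x) = \sum_i \sum_k tr (star (entry_op x k i) * entry_op x k i).
  move=> /inM xM; apply: eq_bigr => i _; rewrite entry_opM.
  rewrite /tr (tr_sum MA Mtr) => [|k _]; last first.
    by rewrite entry_op_star; apply: (saM MA) => //; exact: Ms.
  by apply: eq_bigr => k _; rewrite entry_op_star.
split.
- move=> x y /inM xM /inM yM; rewrite /trA -big_split; apply: eq_bigr => i _.
  by rewrite entry_opD; exact: (trD Mtr).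
- move=> x /[dup] /inM xM /trA_starM ->.
  by apply: sumr_ge0 => i _; apply: sumr_ge0 => k _; exact: (tr_ge0 Mtr).
- move=> x /[dup] /inM xM /trA_starM -> /eqP.
  rewrite psumr_eq0 => [/allP h|i _]; last first.
    by apply: sumr_ge0 => k _; exact: (tr_ge0 Mtr).
  apply: entry_op_inj => k i; rewrite entry_op0.
  have := h i; rewrite mem_index_enum /= => /(_ isT).
  rewrite psumr_eq0 => [/allP/(_ k)|k' _]; last exact: (tr_ge0 Mtr).
  by rewrite mem_index_enum /= => /(_ isT) /eqP; exact: (tr_eq0 Mtr).
- move=> x y /inM xM /inM yM.
  have E z z' : (forall i j, ops M (entry_op z i j)) ->
      (forall i j, ops M (entry_op z' i j)) ->
      trA (z * z') = \sum_i \sum_k tr (entry_op z i k * entry_op z' k i).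
    move=> zM zM'; apply: eq_bigr => i _; rewrite entry_opM.
    by apply: (tr_sum MA Mtr) => k _; exact: (saM MA).
  rewrite !E // exchange_big; apply: eq_bigr => i _; apply: eq_bigr => k _.
  exact: (trC Mtr).
Qed.

Lemma amplification_tracial : tracial (ops N) (fun x => complex.Re (sigma x)).
Proof.
have t1 : 0 < t^-1 by rewrite invr_gt0.
have Atr := matrix_tracial; have NA x := (ops_corner AV Mp pP x).1.
split.
- move=> x y /NA[xA _] /NA[yA _].
  by rewrite !corner_traceE (trD Atr) // mulrDr.
- move=> x /NA[xA _]; rewrite corner_traceE mulr_ge0 ?(ltW t1) //.
  exact: (tr_ge0 Atr).
- move=> x /NA[xA _]; rewrite corner_traceE => /eqP.
  by rewrite mulf_eq0 gt_eqF //= => /eqP; exact: (tr_eq0 Atr).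
- by move=> x y /NA[xA _] /NA[yA _]; rewrite !corner_traceE (trC Atr).
Qed.

Lemma entry_neq0 (x : adjop K) : x != 0 -> exists i j, entry_op x i j != 0.
Proof.
move=> x0; apply: contrapT => h; move/eqP: x0; apply; apply: entry_op_inj => i j.
rewrite entry_op0; apply/eqP/negPn/negP => xij; apply: h; by exists i, j.
Qed.

Lemma unit_op_in m i j : ops M m -> ops (matrix_vna M) (@unit_op R H n m i j).
Proof.
move=> Mm; apply/(ops_matrix_vna M) => k l; rewrite entry_unit_op.
by case: ifP => _ //; exact: sa0.
Qed.

(** Primeness is tested on one nonzero entry of each factor: the [(i, l)] entry of
    [x * unit_op m j k * y] is the [(i, j)] entry of [x], times [m], times the [(k, l)] entry of
    [y]. *)
Lemma amplification_prime : prime_algebra (ops N).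
Proof.
move=> x y /(ops_corner AV Mp pP)[xA px] /(ops_corner AV Mp pP)[yA py].
move=> /entry_neq0[i [j xij]] /entry_neq0[k [l ykl]].
have [m Mm xmy] := II1_prime M_II1 ((ops_matrix_vna M x).1 xA i j)
  ((ops_matrix_vna M y).1 yA k l) xij ykl.
exists (p * unit_op m j k * p).
  apply/(ops_corner AV Mp pP); split.
    apply: (saM AA) => //; apply: (saM AA) => //; exact: unit_op_in.
  by rewrite !mulrA pP.1 -!mulrA pP.1.
have [_ xp] := corner_mul pP px; have [py' _] := corner_mul pP py.
apply: contra_neq xmy => xpy.
have : entry_op (x * unit_op m j k * y) i l = 0.
  rewrite -xp -py' -[in RHS](entry_op0 H i l) -xpy.
  by congr entry_op; rewrite !mulrA.
by rewrite -mulrA entry_opM (bigD1 j) //= unit_op_mul eqxx big1 ?addr0 ?mulrA //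
  => a aj; rewrite unit_op_mul (negPf aj) mulr0.
Qed.

Lemma amplification_finite_factor : finite_factor N sigma.
Proof.
have NV : von_neumann_algebra N := corner_von_neumann AV Mp pP.
split=> //; [exact: amplification_tracial|exact: amplification_prime|].
exists p; last by rewrite corner_trace1.
apply/(is_unitE _ NV); split; first by apply/(ops_corner AV Mp pP); rewrite !pP.1.
by move=> x /(ops_corner AV Mp pP)[_ px]; exact: corner_mul.
Qed.

(** Some [p * unit_op e i i] is nonzero, and its polar part [v] goes from below the [i]-th diagonal
    unit to below [p]. Restricting [v] to a small projection [r] of [M] gives [w]. The ratio is
    [1 / t] because the sum of diagonal traces of the image of [r] is the trace of [r]. *)
Lemma amplification_link (eps : R) : 0 < eps -> exists w w',
  [/\ link M tau N sigma t^-1 w w',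
    0 < complex.Re (tau (w' \o w)) & complex.Re (tau (w' \o w)) < eps].
Proof.
move=> eps0; have [e eU _] := II1_unit M_II1.
have [Me eM] := (is_unitE _ MV).1 eU.
have p0 : p != 0.
  apply/eqP => p0; have := corner_traceE p; rewrite corner_trace1 /trA p0 big1.
    by move=> /eqP; rewrite mulr0 oner_eq0.
  by move=> i _; rewrite entry_op0 /tr (tr0 MA Mtr).
have [k [i pki]] := entry_neq0 p0.
have x0 : p * unit_op e i i != 0.
  apply: contra_neq pki => x0; have := mul_unit_op p e i i k i.
  rewrite x0 entry_op0 eqxx => ->.
  by rewrite ((eM _ ((ops_matrix_vna M p).1 Mp k i)).2).
have xA : ops (matrix_vna M) (p * unit_op e i i).
  by apply: (saM AA) => //; exact: unit_op_in.
have [v [vA vP v0 pv ve]] := exists_partial_isometry AA xA x0.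
have {}pv : p * v = v by apply: pv; rewrite mulrA pP.1.
have ee : e * e = e by case: (eM e Me).
have {}ve : v * unit_op e i i = v.
  apply: ve; rewrite -mulrA; congr (_ * _); apply: entry_op_inj => a b.
  rewrite mul_unit_op !entry_unit_op eqxx andbT.
  by case: (a == i); case: (b == i); rewrite ?mul0r ?ee.
have vi (u : K) : v (hsum_inj i (u i)) = v u.
  rewrite -[in LHS]ve -[in RHS]ve !mulE; congr (v _).
  by rewrite /= /hsum_proj hsum_injE eqxx.
have iv (u : K) : hsum_inj i (star v u i) = star v u.
  have -> : star v u = (star (unit_op e i i) * star v) u by rewrite -starM ve.
  by rewrite mulE /= !hsum_injE eqxx.
(* As [v] reads and [star v] fills only the [i]-th summand, [star v * v] is the matrix with single
   entry [q]; so [q] is a nonzero projection of [M]. *)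
pose q := entry_op (star v * v) i i.
have svA : ops (matrix_vna M) (star v) by exact: (sa_star AA).
have Mq : ops M q by apply: (ops_matrix_vna M _).1; exact: (saM AA).
have qP : is_proj q.
  split; last by rewrite /q -entry_op_star starM starK.
  have svv z : star v (v (star v z)) = star v z by rewrite -[in RHS](starMM_pi vP).
  have qE (u : H) : q u = star v (v (hsum_inj i u)) i by [].
  by apply: adjop_eq => u; rewrite mulE !qE iv svv.
have q0 : q != 0.
  apply: contra_neq v0 => q0; apply: star_mul_eq0; apply: adjop_eq => u.
  rewrite mulE -vi -iv; have -> : star v (v (hsum_inj i (u i))) i = q (u i) by [].
  by rewrite q0 !zeroE; apply/ffunP => j; rewrite hsum_injE ffunE if_same.
have [r [Mr rP r0 qr r_eps]] := II1_small_projection M_II1 eps0 Mq qP q0.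
have rq : r * q = r by rewrite -{1}rP.2 -qP.2 -starM qr rP.2.
pose w := v \o hsum_inj i \o r; pose w' := r \o hsum_proj i \o star v.
have w'wE : w' \o w = r.
  have rqr : r * q * r = r by rewrite rq rP.1.
  exact: (congr1 (@adjop_fun R H) rqr).
have wE (x : adjop H) : w \o x \o w' = v * unit_op (r * x * r) i i * star v by [].
have w'E (y : adjop K) : w' \o y \o w = r * entry_op (star v * y * v) i i * r by [].
have in_N m : ops M m -> ops N (v * unit_op m i i * star v).
  move=> Mm; apply/(ops_corner AV Mp pP); split.
    by apply: (saM AA) => //; apply: (saM AA) => //; exact: unit_op_in.
  have svp : star v * p = star v by rewrite -{1}pP.2 -starM pv.
  by rewrite !mulrA pv -!mulrA svp.
have wwE : w \o w' = v * unit_op (r * r) i i * star v by [].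
exists w, w'; split.
- split.
  + move=> u y; rewrite /w /w' /= hdot_star hsum_inj_adjoint hdot_star.
    by rewrite rP.2.
  + have [c1 c10 v1] := adjop_bound v; have [c2 c20 i2] := hsum_inj_bound H i.
    have [c3 c30 r3] := adjop_bound r; exists (c1 * (c2 * c3)).
      by rewrite !mulr_ge0.
    move=> u; rewrite /w /= -!mulrA (le_trans (v1 _)) // ler_wpM2l //.
    by rewrite (le_trans (i2 _)) // ler_wpM2l.
  + move=> u; have -> : w' (w u) = r u by rewrite -w'wE.
    by rewrite /w /= -[r (r u)]mulE rP.1.
  + move=> x Mx; rewrite wE; apply: in_N.
    by apply: (saM MA) => //; exact: (saM MA).
  + move=> y /(ops_corner AV Mp pP)[yA _]; rewrite w'E.
    apply: (saM MA) => //; apply: (saM MA) => //.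
    apply: (ops_matrix_vna M _).1; apply: (saM AA) => //; exact: (saM AA).
  + by rewrite w'wE.
  + by rewrite wwE; apply: in_N; exact: (saM MA).
  + rewrite w'wE wwE corner_traceE; congr (_ * _).
    have uA : ops (matrix_vna M) (unit_op (r * r) i i).
      by apply: unit_op_in; exact: (saM MA).
    rewrite (trC matrix_tracial) //; last exact: (saM AA).
    rewrite mulrA /trA (bigD1 i) //= big1 => [|k' k'i].
      by rewrite addr0 /tr mul_unit_op eqxx -/q mulrA qr rP.1.
    by rewrite mul_unit_op (negPf k'i) /tr (tr0 MA Mtr).
- by rewrite w'wE; exact: (tr_proj_gt0 Mtr).
- by rewrite w'wE.
Qed.

End Amplification.

(* corner (matrix_vna M) p is the amplification M_t. *)
Theorem corollary5p6 (R : realType) (H : hilbertType R)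
    (M : set (H -> H)) (tau : (H -> H) -> R[i])
    (M_II1 : II1_factor M tau) (M_separable : separable_vna M)
    (t : R) (t_gt0 : 0 < t) (n : nat) (t_lt_n : t < n%:R)
    (p : hsum H n -> hsum H n)
    (Mp : matrix_vna M p) (p_projection : is_projection p)
    (tau_p : matrix_trace tau p = (t / n%:R)%:C) :
  G_sa (corner (matrix_vna M) p) (corner_trace (matrix_trace tau) p) =
    ((t ^- 2)%:E * G_sa M tau)%E.
Proof.
have FM := II1_finite_factor M_II1.
have [x px xM] := matrix_lift (ff_vna FM) Mp; subst p.
have xP : is_proj x by apply/is_projectionE.
have FN := amplification_finite_factor M_II1 t_gt0 t_lt_n Mp xP tau_p.
have links := amplification_link M_II1 t_gt0 t_lt_n Mp xP tau_p.
have ti_gt0 : 0 < t^-1 by rewrite invr_gt0.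
apply/eqP; rewrite eq_le; apply/andP; split.
  by rewrite -exprVn; exact: (G_sa_le FM FN ti_gt0 links).
rewrite lee_pdivrMl ?exprn_gt0 //; apply: (G_sa_le FN FM t_gt0) => eps eps0.
(* The reversed link is measured in the amplification, where traces are divided by [t]; so size
   [eps] there means size [t * eps] in [M]. *)
have [w [w' [L w_gt0 w_lt]]] := links _ (mulr_gt0 t_gt0 eps0).
exists w', w; split.
- by rewrite -[t]invrK; exact: link_sym L.
- by rewrite (link_trace L) mulr_gt0.
- by rewrite (link_trace L) ltr_pdivrMl.
Qed.
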